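(* Let $P$ and $Q$ be $2$-connected positroids on non-crossing subsets of a totally ordered set $X$, such that $|E(P)|\ge 3$, $|E(Q)|\ge 3$, and $E(P)\cap E(Q)=\{e\}$. Then \[\Omega_{P\oplus_2 Q}=\Omega_P\oplus_2\Omega_Q .\]
   Context: An ordered matroid is a (finite) matroid whose ground set is totally ordered. A positroid is an ordered matroid on $\{i_1<\dots<i_n\}$, of rank $r$, that can be realized by a full-rank real $r\times n$ matrix (columns indexed in order) all of whose maximal minors are nonnegative. On $E=\{i_1<\dots<i_n\}$ let $\leq_{i_k}$ be the order $i_k<i_{k+1}<\dots<i_n<i_1<\dots<i_{k-1}$. The Grassmann necklace of an ordered matroid $M$ on $E$ is $\mathcal{J}(M)=(J_1,\dots,J_n)$, with $J_j$ the lexicographically minimal basis of $M$ with respect to $\leq_{i_j}$. For a positroid $P$, its positroid envelope class $\Omega_P$ is the set of all ordered matroids $M$ on the ordered set $E(P)$ with $\mathcal{J}(M)=\mathcal{J}(P)$. Subsets $A,B$ of a totally ordered set $Z$ are crossing if there are $w,y\in A$ and $x,z\in B$ with $w<_w x<_w y<_w z$ (where $\le_w$ is the cyclic shift of the order starting at $w$); otherwise they are non-crossing. Ground sets carry the order induced from $X$. $2$-sum: if $M,N$ are matroids with $|E(M)|,|E(N)|\ge 2$, $E(M)\cap E(N)=\{e\}$, and $e$ is neither a loop nor a coloop of $M$ or of $N$, then $M\oplus_2 N$ is the matroid on $(E(M)\cup E(N))\setminus\{e\}$ whose circuits are $\mathcal{C}(M\setminus e)\cup\mathcal{C}(N\setminus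 e)\cup\{(C_1\cup C_2)\setminus\{e\}: e\in C_1\in\mathcal{C}(M),\, e\in C_2\in\mathcal{C}(N)\}$. The $2$-sum of two positroids on non-crossing subsets is a positroid. The $2$-sum of envelope classes is $\Omega_P\oplus_2\Omega_Q:=\{M\oplus_2 N: M\in\Omega_P,\,N\in\Omega_Q\}$. *)

(* Defs.v *)
From HB Require Import structures.
From mathcomp Require Import all_boot all_order all_algebra finmap.
From mathcomp Require Import boolp classical_sets reals.

Set Implicit Arguments.
Unset Strict Implicit.
Unset Printing Implicit Defensive.

Import Order.TTheory GRing.Theory Num.Theory.

Local Open Scope fset_scope.

(* Finite matroids whose ground set is a finite subset of [X], given by bases. *)
Record matroid (X : choiceType) := Matroid {
  ground : {fset X};
  bases : {fset {fset X}};
  bases_sub : forall B, B \in bases -> B `<=` ground;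
  bases_neq0 : bases != fset0;
  bases_exchange : forall B1 B2 x, B1 \in bases -> B2 \in bases ->
    x \in B1 `\` B2 ->
    exists2 y, y \in B2 `\` B1 & y |` (B1 `\ x) \in bases
}.

Section Matroids.
Variable X : choiceType.
Implicit Types (M N S : matroid X) (A B C I : {fset X}) (e x : X).

Lemma matroid_eq M N : ground M = ground N -> bases M = bases N -> M = N.
Proof.
case: M N => [E Bs p1 p2 p3] [E' Bs' q1 q2 q3] /= eqE eqB; subst E' Bs'.
by congr Matroid; apply: Prop_irrelevance.
Qed.

Definition indep M I : Prop := exists2 B, B \in bases M & I `<=` B.

Definition circuit M C : Prop :=
  [/\ C `<=` ground M, ~ indep M C & forall I, I `<` C -> indep M I].

Definition loop M e : Prop :=
  e \in ground M /\ forall B, B \in bases M -> e \notin B.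

Definition coloop M e : Prop :=
  e \in ground M /\ forall B, B \in bases M -> e \in B.

Definition rk M A : nat := \max_(B <- bases M) #|` A `&` B|.

Definition mrank M : nat := rk M (ground M).

(* Tutte's separations; the inequality is r(A) + r(B) - r(M) < k. *)
Definition separation (k : nat) M A B : Prop :=
  [/\ A `|` B = ground M, [disjoint A & B]%fset, k <= #|` A|, k <= #|` B|
    & rk M A + rk M B < mrank M + k].

Definition tutte_connected (n : nat) M : Prop :=
  forall k A B, 0 < k < n -> ~ separation k M A B.

Definition summable e M N : Prop :=
  [/\ 2 <= #|` ground M|, 2 <= #|` ground N|,
      ground M `&` ground N = [fset e],
      ~ loop M e /\ ~ coloop M e
    & ~ loop N e /\ ~ coloop N e].

(* The circuits of the deletion [M \ e] are the circuits of [M] avoiding [e]. *)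
Definition two_sum_circuit e M N C : Prop :=
  [\/ circuit M C /\ e \notin C,
      circuit N C /\ e \notin C
    | exists C1 C2, [/\ circuit M C1, e \in C1, circuit N C2, e \in C2
                      & C = (C1 `|` C2) `\ e]].

Definition is_two_sum e M N S : Prop :=
  [/\ summable e M N,
      ground S = (ground M `|` ground N) `\ e
    & forall C, circuit S C <-> two_sum_circuit e M N C].

(* A matroid is determined by its ground set and its circuits, so [two_sum] is
   the matroid satisfying [is_two_sum]. The value [M] is a dummy, taken only
   when the 2-sum is undefined, that is, when [summable e M N] fails. *)
Definition two_sum e M N : matroid X :=
  if pselect (exists S, is_two_sum e M N S) is left h then projT1 (cid h)
  else M.

Definition two_sum_class e (Om Om' : set (matroid X)) : set (matroid X) :=
  [set two_sum e M N | M in Om & N in Om']%classic.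

End Matroids.

Section OrderedMatroids.
Variables (d : Order.disp_t) (X : orderType d).
Implicit Types (M P : matroid X) (A B E : {fset X}) (w x y z : X).

(* The cyclic shift of the order of [X] starting at [w]; on a subset [E] of [X]
   containing [w] it restricts to the cyclic shift of the induced order. *)
Definition cyc_le w : rel X := fun x y =>
  if (w <= x)%O == (w <= y)%O then (x <= y)%O else (w <= x)%O.

Definition cyc_lt w : rel X := fun x y => (x != y) && cyc_le w x y.

Definition crossing A B : Prop :=
  exists w x y z, [/\ w \in A, y \in A, x \in B & z \in B]
    /\ [/\ cyc_lt w w x, cyc_lt w x y & cyc_lt w y z].

Definition noncrossing A B : Prop := ~ crossing A B.

Fixpoint seq_lex (T : eqType) (r : rel T) (s t : seq T) : bool :=
  match s, t with
  | [::], _ => true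
  | _ :: _, [::] => false
  | x :: s', y :: t' => if x == y then seq_lex r s' t' else r x y
  end.

Definition fset_lex w : rel {fset X} := fun A B =>
  seq_lex (cyc_le w) (sort (cyc_le w) A) (sort (cyc_le w) B).

(* [fset_lex w] is a total order and [bases M] is nonempty, so this is the least
   basis; the default [fset0] is never used. *)
Definition lexmin_basis M w : {fset X} :=
  head fset0 (sort (fset_lex w) (bases M)).

Definition sorted_elts E : seq X := sort <=%O E.

Definition necklace M : seq {fset X} :=
  [seq lexmin_basis M w | w <- sorted_elts (ground M)].

Definition envelope P : set (matroid X) :=
  [set M | ground M = ground P /\ necklace M = necklace P]%classic.

Definition label E (J : {set 'I_(size (sorted_elts E))}) : {fset X} :=
  [fset tnth (in_tuple (sorted_elts E)) j | j in J].

(* The columns of [A], labelled in order by the elements of the ground set,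
   realize [M] over [R]. *)
Definition realizes (R : fieldType) r M
    (A : 'M[R]_(r, size (sorted_elts (ground M)))) : Prop :=
  forall J : {set 'I_(size (sorted_elts (ground M)))},
    indep M (label J) <-> row_free (colsub (fun k : 'I_#|J| => enum_val k) A)^T.

Definition positroid (R : realType) M : Prop :=
  exists A : 'M[R]_(mrank M, size (sorted_elts (ground M))),
    [/\ \rank A = mrank M, realizes A
      & forall f : 'I_(mrank M) -> 'I_(size (sorted_elts (ground M))),
          {homo f : i j / (i < j)%N} -> (0 <= \det (colsub f A))%R].

End OrderedMatroids.

(* Main.v *)
(* The necklace of a matroid records exactly the ranks of its cyclic intervals:
   by greediness the lexicographically least basis for the order starting at [w]
   meets every initial segment of that order in a set of full rank, and it is
   determined by the sizes of these intersections. So [envelope P] consists of the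
   matroids on the ground set of [P] whose cyclic intervals have the same ranks.

   Write E(P) = A + e and E(Q) = B + e. Non-crossing means that in the cyclic order
   starting at e, one of A, B precedes the other. A 2-sum S satisfies
     r_S(I + J) + 1 = max (r_P(I + e) + r_Q(J), r_P(I) + r_Q(J + e))
   for I in A and J in B, and a cyclic interval of A + B lies in A, or lies in B, or
   cuts both A and B in segments that are cyclic intervals with and without e, or is
   the complement of such a set. Hence 2-sums of members of the envelopes lie in the
   envelope of the 2-sum. Conversely A and B are cyclic intervals, so every S' in the
   envelope of the 2-sum has r(A) + r(B) = r(S') + 1; it is therefore a 2-sum of
   matroids on A + e and B + e, and the ranks of their cyclic intervals are read off
   from those of S'. *)
Require Import Defs.
From mathcomp Require Import all_boot all_order all_algebra finmap.
From mathcomp Require Import boolp classical_sets reals.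
From mathcomp Require Import zify.

Set Implicit Arguments.
Unset Strict Implicit.
Unset Printing Implicit Defensive.

Import Order.TTheory.

(** * Bases, independence, rank and circuits *)

Section Matroids.
Local Open Scope fset_scope.
Variable X : choiceType.
Implicit Types (M N S : matroid X) (A B C D I J Z : {fset X}) (e x y : X).

Lemma card_fset_ltn A B x : A `<=` B -> x \in B -> x \notin A -> #|` A| < #|` B|.
Proof.
move=> sAB xB xA; apply: fproper_ltn_card; rewrite fproperE sAB.
by apply/fsubsetPn; exists x.
Qed.

Lemma card_exchange B x y : x \in B -> y \notin B -> #|` y |` (B `\ x)| = #|` B|.
Proof.
move=> xB yB; rewrite cardfsU1 !inE (negbTE yB) andbF /=.
by rewrite [RHS](cardfsD1 x) xB.
Qed.

(** Each exchange of an element of [B1] outside [B2] for one of [B2] keeps the size of [B1] and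
    brings it closer to [B2]. A basis inside another equals it, since exchange would otherwise need
    an element of the empty difference. *)
Lemma bases_card M B1 B2 : B1 \in bases M -> B2 \in bases M -> #|` B1| = #|` B2|.
Proof.
move: {2}#|` B1 `\` B2| (leqnn #|` B1 `\` B2|) => n.
elim: n B1 => [|n IHn] B1 le_n b1 b2.
  have s12 : B1 `<=` B2 by rewrite -fsetD_eq0 -cardfs_eq0 -leqn0.
  suff s21 : B2 `<=` B1.
    by have -> : B1 = B2 by apply/eqP; rewrite eqEfsubset s12.
  rewrite -fsetD_eq0; apply/eqP/fsetP => x; rewrite in_fset0.
  apply/negP => xB; have [y] := bases_exchange b2 b1 xB.
  by rewrite inE => /andP[yB2 /(fsubsetP s12)]; rewrite (negbTE yB2).
have [s12|/fsubsetPn[x xB1 xB2]] := boolP (B1 `<=` B2).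
  apply: IHn => //; suff -> : B1 `\` B2 = fset0 by rewrite cardfs0.
  by apply/eqP; rewrite fsetD_eq0.
have xD : x \in B1 `\` B2 by rewrite inE xB1 xB2.
have [y /[!inE]/andP[yB1 yB2] b'] := bases_exchange b1 b2 xD.
rewrite -(card_exchange xB1 yB1); apply: IHn => //.
rewrite -ltnS; apply: leq_trans le_n.
apply: (@card_fset_ltn _ _ x); rewrite ?inE ?xB1 ?xB2 //=.
  apply/fsubsetP => z; rewrite !inE.
  by case/andP => zB2 /orP[/eqP zy|/andP[_ ->]]; [rewrite zy yB2 in zB2 | rewrite zB2].
by rewrite eqxx orbF; apply: contraNneq yB1 => <-.
Qed.

Lemma indep_basis M B : B \in bases M -> indep M B.
Proof. by move=> bB; exists B. Qed.

Lemma indepS M A B : A `<=` B -> indep M B -> indep M A.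
Proof. by move=> sAB [Z bZ sBZ]; exists Z => //; apply: fsubset_trans sBZ. Qed.

Lemma indep0 M : indep M fset0.
Proof. by have [B bB] := fset0Pn _ (bases_neq0 M); exists B. Qed.

Lemma indep_ground M I : indep M I -> I `<=` ground M.
Proof. by case=> B /bases_sub sB sI; apply: fsubset_trans sB. Qed.

(** Starting from a basis above [I], the elements outside [I] and [B] are exchanged one by one for
    elements of [B]. *)
Lemma indep_extend M I B : indep M I -> B \in bases M ->
  exists2 B', B' \in bases M & I `<=` B' /\ B' `<=` I `|` B.
Proof.
case=> B0 b0 sI bB.
move: {2}#|` B0 `\` (I `|` B)| (leqnn #|` B0 `\` (I `|` B)|) => n.
elim: n B0 b0 sI => [|n IHn] B0 b0 sI le_n.
  by exists B0 => //; split => //; rewrite -fsetD_eq0 -cardfs_eq0 -leqn0.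
have [s0|/fsubsetPn[x x0]] := boolP (B0 `<=` I `|` B); first by exists B0.
rewrite inE negb_or => /andP[xI xB].
have xD : x \in B0 `\` B by rewrite inE x0 xB.
have [y /[!inE]/andP[y0 yB] b'] := bases_exchange b0 bB xD.
apply: (IHn _ b').
  apply/fsubsetP => z zI; rewrite !inE (fsubsetP sI) // andbT.
  by apply/orP; right; apply: contraNneq xI => <-.
rewrite -ltnS; apply: leq_trans le_n.
apply: (@card_fset_ltn _ _ x); rewrite ?inE ?negb_or ?xI ?xB //=.
  apply/fsubsetP => z; rewrite !inE.
  case/andP => zIB /orP[/eqP zy|/andP[_ ->]]; last by rewrite zIB.
  by move: zIB; rewrite zy yB orbT.
by rewrite eqxx orbF; apply: contraNneq y0 => <-.
Qed.

Lemma leq_rk M A B : B \in bases M -> #|` A `&` B| <= rk M A.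
Proof. by move=> bB; exact: (@leq_bigmax_seq _ _ xpredT (fun Z => #|` A `&` Z|) B). Qed.

Lemma rk_witness M A : exists2 B, B \in bases M & #|` A `&` B| = rk M A.
Proof.
have [B0 b0] := fset0Pn _ (bases_neq0 M).
(* Induction on the maximum also yields its default value 0; in that case any basis attains it. *)
suff [E|//] : rk M A = 0 \/ exists2 B, B \in bases M & #|` A `&` B| = rk M A.
  by exists B0 => //; apply/eqP; rewrite E -leqn0 -E leq_rk.
rewrite /rk big_seq; elim/big_ind: _ => [|m n Hm Hn|B bB]; first by left.
  by rewrite /maxn; case: ltnP.
by right; exists B.
Qed.

(** Extend [I] by a basis that attains the rank of [A]. As [I] lies in [A], the result has no new
    elements outside [A], hence at least as many inside. *)
Lemma rk_extend M I A : indep M I -> I `<=` A ->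
  exists2 B, B \in bases M & I `<=` B /\ #|` A `&` B| = rk M A.
Proof.
move=> iI sIA; have [B bB rB] := rk_witness M A.
have [B' b' [sI sB']] := indep_extend iI bB; exists B' => //; split => //.
apply/eqP; rewrite eqn_leq leq_rk //= -rB.
have sD : B' `\` A `<=` B `\` A.
  apply/fsubsetP => z; rewrite !inE => /andP[zA /(fsubsetP sB')].
  by rewrite inE zA => /orP[/(fsubsetP sIA)|//]; rewrite (negbTE zA).
have := fsubset_leq_card sD; have := bases_card b' bB.
have := cardfsID A B'; have := cardfsID A B; rewrite ![_ `&` A]fsetIC; lia.
Qed.

Lemma rk_basis M A B : B \in bases M -> B `<=` A -> rk M A = #|` B|.
Proof.
move=> bB sBA; have [B' b' [sB <-]] := rk_extend (indep_basis bB) sBA.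
have <- : B = B'; first by apply/eqP; rewrite eqEfcard sB (bases_card b' bB) /=.
by congr (size (enum_fset _)); apply/fsetIidPr.
Qed.

Lemma mrankE M B : B \in bases M -> mrank M = #|` B|.
Proof. by move=> bB; apply: rk_basis => //; apply: bases_sub. Qed.

Lemma indep_basisP M B : reflect (indep M B /\ #|` B| = mrank M) (B \in bases M).
Proof.
apply: (iffP idP) => [bB|[[B' b' sB] cB]].
  by split; [exact: indep_basis | rewrite (mrankE bB)].
suff -> : B = B' by [].
by apply/eqP; rewrite eqEfcard sB cB (mrankE b') leqnn.
Qed.

Lemma rkS M A B : A `<=` B -> rk M A <= rk M B.
Proof.
move=> sAB; have [Z bZ <-] := rk_witness M A.
by apply: leq_trans (leq_rk B bZ); apply/fsubset_leq_card/fsetSI.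
Qed.

Lemma rkU1 M A x : rk M (x |` A) <= (rk M A).+1.
Proof.
have [Z bZ <-] := rk_witness M (x |` A).
have := leq_rk A bZ; rewrite fsetIUl cardfsU.
have : #|` [fset x] `&` Z| <= 1 by rewrite -(cardfs1 x) fsubset_leq_card ?fsubsetIl.
lia.
Qed.

Lemma rk0 M : rk M fset0 = 0.
Proof. by have [Z _ <-] := rk_witness M fset0; rewrite fset0I cardfs0. Qed.

Lemma circuit_neq0 M C : circuit M C -> C != fset0.
Proof. by case=> _ nC _; apply: contra_notN nC => /eqP ->; exact: indep0. Qed.

Lemma dependent_circuit M A : A `<=` ground M -> ~ indep M A ->
  exists2 C, circuit M C & C `<=` A.
Proof.
move: {2}#|` A| (leqnn #|` A|) => n; elim: n A => [|n IHn] A le_n sA dA.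
  by case: dA; move: le_n; rewrite leqn0 cardfs_eq0 => /eqP ->; exact: indep0.
have [[I sI dI]|H] := pselect (exists2 I, I `<` A & ~ indep M I).
  have sIA := fproper_sub sI.
  have [||C cC sC] := IHn I _ _ dI.
  - by rewrite -ltnS (leq_trans (fproper_ltn_card sI)).
  - exact: fsubset_trans sA.
  - by exists C => //; apply: fsubset_trans sIA.
exists A => //; split => // I sI; apply: contrapT => dI; apply: H.
by exists I.
Qed.

Lemma indep_circuitP M A : A `<=` ground M ->
  indep M A <-> ~ exists2 C, circuit M C & C `<=` A.
Proof.
move=> sA; split=> [iA [C [_ dC _] sC]|H]; first by apply: dC; apply: indepS iA.
by apply: contrapT => dA; apply: H; apply: dependent_circuit.
Qed.

Lemma circuit_antichain M C C' : circuit M C -> circuit M C' -> ~ C `<` C'.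
Proof. by case=> _ dC _ [_ _ H] sC; apply: dC; apply: H. Qed.

(** Circuits determine the independent sets, these the size of a basis, and both together the
    bases. *)
Lemma eq_circuit_matroid M N : ground M = ground N ->
  (forall C, circuit M C <-> circuit N C) -> M = N.
Proof.
move=> gE cE; have iE I : indep M I <-> indep N I.
  have [sI|nsI] := boolP (I `<=` ground M); last first.
    by split=> /indep_ground; rewrite -?gE (negbTE nsI).
  rewrite !indep_circuitP -?gE //.
  by split=> H [C /cE cC sC]; apply: H; exists C.
have rE : mrank M = mrank N.
  have [B bB] := fset0Pn _ (bases_neq0 M); have [B' bB'] := fset0Pn _ (bases_neq0 N).
  have [D bD /fsubset_leq_card] := (iE B).1 (indep_basis bB).
  have [D' bD' /fsubset_leq_card] := (iE B').2 (indep_basis bB').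
  rewrite (mrankE bB) (mrankE bB') -(bases_card bB bD') -(bases_card bB' bD); lia.
apply: matroid_eq => //; apply/fsetP => B.
by apply/indep_basisP/indep_basisP; rewrite rE => -[/iE].
Qed.

(** * 2-sums through bases *)

(** The 2-sum described by bases instead of circuits. Exchange and ranks are derived from this form;
    [two_sum_bases_is_two_sum] leads back to circuits. *)
Definition two_sum_basis e M N Z : Prop :=
  exists B1 B2, [/\ B1 \in bases M, B2 \in bases N, (e \in B1) != (e \in B2)
                  & Z = (B1 `|` B2) `\ e].

Definition two_sum_bases e M N S : Prop :=
  ground S = (ground M `|` ground N) `\ e /\
  forall Z, Z \in bases S <-> two_sum_basis e M N Z.

Lemma two_sum_basisC e M N Z : two_sum_basis e M N Z -> two_sum_basis e N M Z.
Proof.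
by case=> B1 [B2 [b1 b2 eB ->]]; exists B2, B1; rewrite eq_sym fsetUC.
Qed.

Lemma two_sum_basesC e M N S : two_sum_bases e M N S -> two_sum_bases e N M S.
Proof.
case=> gS bS; split=> [|Z]; first by rewrite fsetUC.
by rewrite bS; split=> /two_sum_basisC.
Qed.

Lemma summableC e M N : summable e M N -> summable e N M.
Proof. by case=> *; split; rewrite // fsetIC. Qed.

Lemma not_loopP M e : e \in ground M ->
  ~ loop M e <-> exists2 B, B \in bases M & e \in B.
Proof.
move=> eM; split=> [nl|[B bB eB] [_ /(_ B bB)]]; last by rewrite eB.
apply: contrapT => H; apply: nl; split => // B bB.
by apply/negP => eB; apply: H; exists B.
Qed.

Lemma not_coloopP M e : e \in ground M ->
  ~ coloop M e <-> exists2 B, B \in bases M & e \notin B.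
Proof.
move=> eM; split=> [nl|[B bB eB] [_ /(_ B bB)]]; last by rewrite (negbTE eB).
apply: contrapT => H; apply: nl; split => // B bB.
by apply: contrapT => /negP eB; apply: H; exists B.
Qed.

Lemma summable_ground e M N : summable e M N -> e \in ground M /\ e \in ground N.
Proof. by case=> _ _ gE _ _; apply/andP; rewrite -in_fsetI gE inE. Qed.

Lemma summable_bases e M N : summable e M N ->
  [/\ exists2 B, B \in bases M & e \in B, exists2 B, B \in bases M & e \notin B,
      exists2 B, B \in bases N & e \in B & exists2 B, B \in bases N & e \notin B].
Proof.
move=> sMN; have [eM eN] := summable_ground sMN.
by case: sMN => _ _ _ [/not_loopP + /not_coloopP +] [/not_loopP + /not_coloopP +]; split; auto.
Qed.

Lemma notin_other M N e x : ground M `&` ground N = [fset e] -> x != e ->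
  x \in ground M -> x \notin ground N.
Proof.
move=> gE xe xM; apply: contra xe => xN.
by rewrite -in_fset1 -gE inE xM xN.
Qed.

Lemma fsub_other0 M N e A A' : ground M `&` ground N = [fset e] ->
  A `<=` ground M -> A' `<=` ground N -> e \notin A -> A `<=` A' -> A = fset0.
Proof.
move=> gE sA sA' eA sAA'; apply/fsetP => z; rewrite in_fset0; apply/negP => zA.
have ze : z != e by apply: contraNneq eA => <-.
by have := notin_other gE ze (fsubsetP sA z zA); rewrite (fsubsetP sA') ?(fsubsetP sAA').
Qed.

(** Exchange [x] inside [M]. Only if [e] comes in is a second exchange needed, in [N], to remove [e]
    from the other basis. *)
Lemma two_sum_exchange e M N B1 B2 B1' B2' x :
  ground M `&` ground N = [fset e] ->
  B1 \in bases M -> B2 \in bases N -> (e \in B1) != (e \in B2) ->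
  B1' \in bases M -> B2' \in bases N -> (e \in B1') != (e \in B2') ->
  x != e -> x \in B1 `\` B1' ->
  exists2 y, y \in (B1' `|` B2') `\ e `\` ((B1 `|` B2) `\ e)
           & two_sum_basis e M N (y |` ((B1 `|` B2) `\ e `\ x)).
Proof.
move=> gE b1 b2 e12 b1' b2' e12' xe xD.
have gE' : ground N `&` ground M = [fset e] by rewrite fsetIC.
have [x1 x1'] : x \in B1 /\ x \notin B1' by move: xD; rewrite inE => /andP[].
have subs := (fsubsetP (bases_sub b1), fsubsetP (bases_sub b1'),
              fsubsetP (bases_sub b2), fsubsetP (bases_sub b2')).
have x2 : x \notin B2.
  by apply: contra (notin_other gE xe (subs.1.1.1 _ x1)); apply: subs.1.2.
have [y /[!inE]/andP[y1 y1'] b] := bases_exchange b1 b1' xD.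
have yx : y != x by apply: contraNneq y1 => ->.
have [ye|ye] := eqVneq y e; last first.
  have y2 : y \notin B2.
    by apply: contra (notin_other gE ye (subs.1.1.2 _ y1')); apply: subs.1.2.
  exists y; first by rewrite !inE ye y1' (negbTE y1) (negbTE y2).
  exists (y |` (B1 `\ x)), B2; split => //.
    by rewrite !inE ![e == _]eq_sym (negbTE ye) xe.
  apply/fsetP => z; rewrite !inE.
  have [->|zy] := eqVneq z y; first by rewrite ye.
  by have [->|zx] := eqVneq z x; rewrite ?(negbTE x2) ?andbF ?andbT.
(* Here [e] has entered the basis of [M], so it must leave [B2]; the element [w] replacing it in [N]
   is the one that enters the basis of the 2-sum. *)
subst y; have e2 : e \in B2 by move: e12; rewrite (negbTE y1); case: (e \in B2).
have e2' : e \notin B2' by move: e12'; rewrite y1'; case: (e \in B2').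
have eD : e \in B2 `\` B2' by rewrite inE e2 e2'.
have [w /[!inE]/andP[w2 w2'] b'] := bases_exchange b2 b2' eD.
have we : w != e by apply: contraNneq w2 => ->.
have w1 : w \notin B1.
  by apply: contra (notin_other gE' we (subs.2 _ w2')); apply: subs.1.1.1.
exists w; first by rewrite !inE we w2' (negbTE w1) (negbTE w2) orbT.
exists (e |` (B1 `\ x)), (w |` (B2 `\ e)); split => //.
  by rewrite !inE eqxx ![e == _]eq_sym (negbTE we).
apply/fsetP => z; rewrite !inE.
have [->|zw] := eqVneq z w; first by rewrite we /= !orbT.
have [->|ze] := eqVneq z e; first by rewrite andbF.
by have [->|zx] := eqVneq z x; rewrite ?(negbTE x2).
Qed.

Lemma exists_two_sum_bases e M N : summable e M N -> exists S, two_sum_bases e M N S.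
Proof.
move=> sMN; have [[B1 b1 e1] _ _ [B2 b2 e2]] := summable_bases sMN.
have gE : ground M `&` ground N = [fset e] by case: sMN.
pose E := (ground M `|` ground N) `\ e.
have sub Z : two_sum_basis e M N Z -> Z `<=` E.
  case=> C1 [C2 [/bases_sub c1 /bases_sub c2 _ ->]].
  exact/fsetSD/fsetUSS.
pose Bs := [fset Z in fpowerset E | `[< two_sum_basis e M N Z >]].
have inBs Z : Z \in Bs <-> two_sum_basis e M N Z.
  rewrite !inE fpowersetE; split=> [/andP[_ /asboolP]//|tZ].
  by rewrite sub //; apply/asboolP.
have Bs_sub Z : Z \in Bs -> Z `<=` E by move/inBs/sub.
have Bs0 : Bs != fset0.
  apply/fset0Pn; exists ((B1 `|` B2) `\ e); apply/inBs.
  by exists B1, B2; split => //; rewrite e1 (negbTE e2).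
have exch Z Z' x : Z \in Bs -> Z' \in Bs -> x \in Z `\` Z' ->
    exists2 y, y \in Z' `\` Z & y |` (Z `\ x) \in Bs.
  move=> /inBs[C1 [C2 [c1 c2 ec ->]]] /inBs[C1' [C2' [c1' c2' ec' ->]]] /[!inE].
  case/andP; rewrite negb_and negb_or negbK => + /andP[xe].
  (* The element [x] belongs to one of the two summands; the second case is the first with [M] and
     [N] interchanged. *)
  rewrite (negbTE xe) /= => /andP[x1' x2'] /orP[xC|xC].
    have [|y yD /inBs] := two_sum_exchange gE c1 c2 ec c1' c2' ec' xe.
      by rewrite inE xC x1'.
    by exists y.
  rewrite (fsetUC C1) (fsetUC C1').
  have gE' : ground N `&` ground M = [fset e] by rewrite fsetIC.
  have [|||y yD /two_sum_basisC/inBs] := two_sum_exchange gE' c2 c1 _ c2' c1' _ xe.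
  - by rewrite eq_sym.
  - by rewrite eq_sym.
  - by rewrite inE xC x2'.
  - by exists y.
by exists (Matroid Bs_sub Bs0 exch).
Qed.

(** The alternative records which of the two bases contains [e]. Conversely, the part without [e] is
    extended by a basis avoiding [e], so that the two bases disagree at [e]. *)
Lemma two_sum_bases_indep e M N S I1 I2 : summable e M N -> two_sum_bases e M N S ->
  I1 `<=` ground M `\ e -> I2 `<=` ground N `\ e ->
  indep S (I1 `|` I2) <->
    (indep M (e |` I1) /\ indep N I2) \/ (indep M I1 /\ indep N (e |` I2)).
Proof.
have main M' N' S' J1 J2 : summable e M' N' -> two_sum_bases e M' N' S' ->
    J2 `<=` ground N' `\ e -> indep M' (e |` J1) -> J1 `<=` ground M' `\ e ->
    indep N' J2 -> indep S' (J1 `|` J2).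
  move=> sMN [_ bS] s2 [B1 b1 sB1] s1 i2.
  have [_ _ _ [B b eB]] := summable_bases sMN.
  have [B2 b2 [sB2 sB2']] := indep_extend i2 b.
  exists ((B1 `|` B2) `\ e).
    apply/bS; exists B1, B2; split => //.
    rewrite (fsubsetP sB1) ?inE ?eqxx //=.
    apply: contra eB => /(fsubsetP sB2'); rewrite inE => /orP[/(fsubsetP s2)|//].
    by rewrite !inE eqxx.
  apply/fsubsetP => z; rewrite !inE => /orP[zJ|zJ].
    move: (fsubsetP s1 z zJ); rewrite !inE => /andP[-> _] /=.
    by rewrite (fsubsetP sB1) // !inE zJ orbT.
  move: (fsubsetP s2 z zJ); rewrite !inE => /andP[-> _] /=.
  by rewrite (fsubsetP sB2) ?orbT.
move=> sMN bS s1 s2; split; last first.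
  case=> -[i1 i2]; first exact: main sMN bS s2 i1 s1 i2.
  by rewrite fsetUC; apply: main (summableC sMN) (two_sum_basesC bS) s1 i2 s2 i1.
have gE : ground M `&` ground N = [fset e] by case: sMN.
have gE' : ground N `&` ground M = [fset e] by rewrite fsetIC.
case=> Z /bS.2[B1 [B2 [b1 b2 eB ->]]] sZ.
have t1 : I1 `<=` B1.
  apply/fsubsetP => z zI; have := fsubsetP s1 z zI; rewrite !inE => /andP[ze zM].
  have := fsubsetP sZ z; rewrite !inE zI ze /= => /(_ isT)/orP[//|zB].
  by have := notin_other gE ze zM; rewrite (fsubsetP (bases_sub b2)).
have t2 : I2 `<=` B2.
  apply/fsubsetP => z zI; have := fsubsetP s2 z zI; rewrite !inE => /andP[ze zN].
  have := fsubsetP sZ z; rewrite !inE zI ze orbT => /(_ isT)/orP[zB|//].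
  by have := notin_other gE' ze zN; rewrite (fsubsetP (bases_sub b1)).
have [e1|e1] := boolP (e \in B1); [left|right].
  by split; [exists B1|exists B2] => //; rewrite fsubUset fsub1set e1.
split; [exists B1|exists B2] => //; rewrite fsubUset fsub1set t2 andbT.
by move: eB; rewrite (negbTE e1); case: (e \in B2).
Qed.

(** * Circuits of 2-sums *)

(** Members of [D] are the minimal dependent sets: the dependent sets are those containing a member,
    and no member properly contains another. *)
Lemma eq_circuit S (D : {fset X} -> Prop) :
  (forall A, A `<=` ground S -> ~ indep S A <-> exists2 C, D C & C `<=` A) ->
  (forall C, D C -> C `<=` ground S) ->
  (forall C C', D C -> D C' -> ~ C `<` C') ->
  forall C, circuit S C <-> D C.
Proof.
move=> dS sD aD C; split=> [[sC dC iC]|DC].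
  have [C' DC' /eqVfproper[<- //|pC]] := (dS C sC).1 dC.
  have sC' := fsubset_trans (fproper_sub pC) sC.
  by case: ((dS C' sC').2 _ (iC _ pC)); exists C'.
have sC := sD C DC; split=> // [|I pI].
  by apply: (dS C sC).2; exists C.
apply: contrapT => /(dS I (fsubset_trans (fproper_sub pI) sC)).1[C' DC' sC'].
exact: aD DC' DC (fsub_proper_trans sC' pI).
Qed.

Lemma fsubset_splitU A A1 A2 : A `<=` A1 `|` A2 -> A = A `&` A1 `|` A `&` A2.
Proof. by move=> sA; rewrite -fsetIUr; apply/esym/fsetIidPl. Qed.

Lemma circuit_join_sub M N e C1 C2 C1' C2' : ground M `&` ground N = [fset e] ->
  circuit M C1 -> circuit N C2 -> circuit M C1' -> circuit N C2' -> e \in C1' ->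
  (C1 `|` C2) `\ e `<=` (C1' `|` C2') `\ e -> C1 `<=` C1'.
Proof.
move=> gE [s1 _ _] [s2 _ _] [s1' _ _] [s2' _ _] eC /fsubsetP sC.
apply/fsubsetP => z z1; have [->//|ze] := eqVneq z e.
have := sC z; rewrite !inE ze z1 => /(_ isT)/orP[//|/(fsubsetP s2')].
by rewrite (negbTE (notin_other gE ze (fsubsetP s1 z z1))).
Qed.

(** The summands share only [e]. A strict inclusion therefore makes some circuit empty or equal to
    the non-loop [e], or else restricts to an inclusion between circuits of one summand. *)
Lemma two_sum_circuit_antichain e M N C C' : summable e M N ->
  two_sum_circuit e M N C -> two_sum_circuit e M N C' -> ~ C `<` C'.
Proof.
move=> sMN; have [[Bm bm em] _ [Bn bn en] _] := summable_bases sMN.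
have gE : ground M `&` ground N = [fset e] by case: sMN.
have gE' : ground N `&` ground M = [fset e] by rewrite fsetIC.
have D1 (K : {fset X}) : K `\ e = fset0 -> K `<=` [fset e].
  by move=> /eqP; rewrite fsetD_eq0.
case=> [[cC eC]|[cC eC]|[C1 [C2 [c1 e1 c2 e2 ->]]]];
  case=> [[cC' eC']|[cC' eC']|[C1' [C2' [c1' e1' c2' e2' ->]]]].
- exact: circuit_antichain cC cC'.
- move=> /fproper_sub s; have := circuit_neq0 cC.
  by rewrite (@fsub_other0 _ _ _ C C' gE) ?eqxx //; [case: cC|case: cC'].
- move=> /fproper_sub s; apply: (circuit_antichain cC c1').
  rewrite fproperE; apply/andP; split; last by apply: contra eC => /fsubsetP->.
  apply/fsubsetP => z zC; have := fsubsetP s z zC; rewrite !inE => /andP[ze].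
  case/orP=> // zC2; case: cC c2' => sC _ _ [sC2 _ _].
  have := notin_other gE ze (fsubsetP sC z zC).
  by rewrite (fsubsetP sC2).
- move=> /fproper_sub s; have := circuit_neq0 cC.
  by rewrite (@fsub_other0 _ _ _ C C' gE') ?eqxx //; [case: cC|case: cC'].
- exact: circuit_antichain cC cC'.
- move=> /fproper_sub s; apply: (circuit_antichain cC c2').
  rewrite fproperE; apply/andP; split; last by apply: contra eC => /fsubsetP->.
  apply/fsubsetP => z zC; have := fsubsetP s z zC; rewrite !inE => /andP[ze].
  case/orP=> // zC1; case: cC c1' => sC _ _ [sC1 _ _].
  have := notin_other gE' ze (fsubsetP sC z zC).
  by rewrite (fsubsetP sC1).
(* Inclusion in a circuit of [M] leaves nothing but [e] in [C2], while [e] is not a loop of [N]. *)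
- move=> /fproper_sub s; case: (c2) => s2 + _; apply.
  apply: (indepS (B := [fset e])); last by exists Bn; rewrite ?fsub1set.
  apply: D1; apply: (@fsub_other0 _ _ _ _ C' gE').
  + by apply: fsubset_trans s2; apply: fsubD1set.
  + by case: cC'.
  + by rewrite !inE eqxx.
  + by apply: fsubset_trans s; apply/fsetSD/fsubsetUr.
- move=> /fproper_sub s; case: (c1) => s1 + _; apply.
  apply: (indepS (B := [fset e])); last by exists Bm; rewrite ?fsub1set.
  apply: D1; apply: (@fsub_other0 _ _ _ _ C' gE).
  + by apply: fsubset_trans s1; apply: fsubD1set.
  + by case: cC'.
  + by rewrite !inE eqxx.
  + by apply: fsubset_trans s; apply/fsetSD/fsubsetUl.
- move=> p; have s := fproper_sub p.
  have E1 : C1 = C1'.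
    have /eqVfproper[//|pC] := circuit_join_sub gE c1 c2 c1' c2' e1' s.
    by case: (circuit_antichain c1 c1' pC).
  rewrite fsetUC (fsetUC C1') in s.
  have E2 : C2 = C2'.
    have /eqVfproper[//|pC] := circuit_join_sub gE' c2 c1 c2' c1' e2' s.
    by case: (circuit_antichain c2 c2' pC).
  by move: p; rewrite E1 E2 (negbTE (fproper_irrefl _)).
Qed.

Lemma two_sum_bases_is_two_sum e M N S : summable e M N -> two_sum_bases e M N S ->
  is_two_sum e M N S.
Proof.
move=> sMN bS; have gS := bS.1; split => //.
have gE : ground M `&` ground N = [fset e] by case: sMN.
have [eM eN] := summable_ground sMN.
have sg C : two_sum_circuit e M N C -> C `<=` ground S.
  rewrite gS; case=> [[[sC _ _] eC]|[[sC _ _] eC]|[C1 [C2 [[s1 _ _] _ [s2 _ _] _ ->]]]].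
  - by rewrite fsubsetD1 eC andbT (fsubset_trans sC) ?fsubsetUl.
  - by rewrite fsubsetD1 eC andbT (fsubset_trans sC) ?fsubsetUr.
  - exact/fsetSD/fsetUSS.
apply: eq_circuit => // [A sA|C C']; last exact: two_sum_circuit_antichain.
pose A1 := A `&` (ground M `\ e); pose A2 := A `&` (ground N `\ e).
have AE : A = A1 `|` A2.
  by apply: fsubset_splitU; move: sA; rewrite gS fsetDUl.
have s1 : A1 `<=` ground M `\ e by apply: fsubsetIr.
have s2 : A2 `<=` ground N `\ e by apply: fsubsetIr.
have e1 : e \notin A1 by rewrite !inE eqxx andbF.
have e2 : e \notin A2 by rewrite !inE eqxx andbF.
have g1 : A1 `<=` ground M by apply: fsubset_trans s1 (fsubD1set _ _).
have g2 : A2 `<=` ground N by apply: fsubset_trans s2 (fsubD1set _ _).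
have ge1 : e |` A1 `<=` ground M by rewrite fsubUset fsub1set eM.
have ge2 : e |` A2 `<=` ground N by rewrite fsubUset fsub1set eN.
rewrite [in indep _ _]AE (two_sum_bases_indep sMN bS s1 s2); split.
  (* If [A1] or [A2] is dependent, it contains a circuit avoiding [e]. If both are independent,
     adding [e] makes both dependent, and the two circuits that arise pass through [e] and can be
     joined. *)
  move=> nA.
  have [i1|d1] := pselect (indep M A1); last first.
    have [C cC sC] := dependent_circuit g1 d1; exists C.
      by constructor 1; split => //; apply: contra e1 => /(fsubsetP sC).
    by rewrite AE (fsubset_trans sC) ?fsubsetUl.
  have [i2|d2] := pselect (indep N A2); last first.
    have [C cC sC] := dependent_circuit g2 d2; exists C.
      by constructor 2; split => //; apply: contra e2 => /(fsubsetP sC).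
    by rewrite AE (fsubset_trans sC) ?fsubsetUr.
  have [C1 c1 sC1] : exists2 C, circuit M C & C `<=` e |` A1.
    by apply: dependent_circuit => // i; apply: nA; left.
  have [C2 c2 sC2] : exists2 C, circuit N C & C `<=` e |` A2.
    by apply: dependent_circuit => // i; apply: nA; right.
  exists ((C1 `|` C2) `\ e); last first.
    by rewrite fsubDset AE fsetUUr fsetUSS.
  constructor 3; exists C1, C2; split => //; apply: contrapT => /negP eC.
    case: c1 => _ + _; apply; apply: indepS i1.
    by rewrite -(fsetU1K e1) fsubsetD1 sC1.
  case: c2 => _ + _; apply; apply: indepS i2.
  by rewrite -(fsetU1K e2) fsubsetD1 sC2.
case=> C tC sC; have sCg := sg _ tC.
have inM z : z \in C -> z \in ground M -> z \in A1.
  move=> zC zM; rewrite !inE (fsubsetP sC) // zM andbT.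
  by have := fsubsetP sCg z zC; rewrite gS !inE => /andP[].
have inN z : z \in C -> z \in ground N -> z \in A2.
  move=> zC zN; rewrite !inE (fsubsetP sC) // zN andbT.
  by have := fsubsetP sCg z zC; rewrite gS !inE => /andP[].
case: tC => [[cC eC]|[cC eC]|[C1 [C2 [c1 eC1 c2 eC2 CE]]]].
- have sC1 : C `<=` A1.
    by apply/fsubsetP => z zC; apply: inM => //; case: cC => /fsubsetP sM _ _; apply: sM.
  case: cC => _ dC _; case=> -[i1 i2]; apply: dC; last exact: indepS i1.
  by apply: indepS i1; apply: fsubset_trans sC1 (fsubsetUr _ _).
- have sC2 : C `<=` A2.
    by apply/fsubsetP => z zC; apply: inN => //; case: cC => /fsubsetP sN _ _; apply: sN.
  case: cC => _ dC _; case=> -[i1 i2]; apply: dC; first exact: indepS i2.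
  by apply: indepS i2; apply: fsubset_trans sC2 (fsubsetUr _ _).
- have sC1 : C1 `<=` e |` A1.
    apply/fsubsetP => z zC; rewrite in_fset1U; have [//|ze] := eqVneq z e.
    apply: inM; first by rewrite CE !inE ze zC.
    by case: c1 => /fsubsetP s _ _; apply: s.
  have sC2 : C2 `<=` e |` A2.
    apply/fsubsetP => z zC; rewrite in_fset1U; have [//|ze] := eqVneq z e.
    apply: inN; first by rewrite CE !inE ze zC orbT.
    by case: c2 => /fsubsetP s _ _; apply: s.
  case: c1 c2 => _ d1 _ [_ d2 _] [[i1 _]|[_ i2]]; first exact: d1 (indepS sC1 i1).
  exact: d2 (indepS sC2 i2).
Qed.

Lemma is_two_sum_inj e M N S S' :
  is_two_sum e M N S -> is_two_sum e M N S' -> S = S'.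
Proof.
case=> _ gS cS [_ gS' cS']; apply: eq_circuit_matroid; first by rewrite gS.
by move=> C; rewrite cS cS'.
Qed.

Lemma two_sumE e M N S : is_two_sum e M N S -> two_sum e M N = S.
Proof.
move=> tS; rewrite /two_sum; case: pselect => [h|[]]; last by exists S.
by apply: (is_two_sum_inj (projT2 (cid h))).
Qed.

Lemma two_sum_bases_two_sum e M N : summable e M N ->
  two_sum_bases e M N (two_sum e M N).
Proof.
move=> sMN; have [S bS] := exists_two_sum_bases sMN.
by rewrite (two_sumE (two_sum_bases_is_two_sum sMN bS)).
Qed.

(** * Rank of 2-sums *)

(** A maximal trace on [A] is completed by elements of a basis avoiding [e]. *)
Lemma rk_witness_avoid M A e : e \notin A -> (exists2 B, B \in bases M & e \notin B) ->
  exists B, [/\ B \in bases M, e \notin B & #|` A `&` B| = rk M A].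
Proof.
move=> eA [B0 b0 e0]; have [Z bZ rZ] := rk_witness M A.
have iI : indep M (A `&` Z) by exists Z; rewrite ?fsubsetIr.
have [B b [sB sB']] := indep_extend iI b0; exists B; split => //.
  by apply: contra e0 => /(fsubsetP sB'); rewrite !inE (negbTE eA).
apply/eqP; rewrite eqn_leq leq_rk //= -rZ; apply: fsubset_leq_card.
by rewrite fsubsetI fsubsetIl.
Qed.

Lemma rk_witness_contain M A e : (exists2 B, B \in bases M & e \in B) ->
  exists B, [/\ B \in bases M, e \in B & #|` (e |` A) `&` B| = rk M (e |` A)].
Proof.
move=> [B0 b0 e0]; have [||B b []] := @rk_extend M [fset e] (e |` A).
- by exists B0; rewrite ?fsub1set.
- by rewrite fsub1set !inE eqxx.
- by rewrite fsub1set => eB rB; exists B.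
Qed.

Lemma card_fsetIU1 A B e : e \notin A -> e \in B ->
  #|` (e |` A) `&` B| = (#|` A `&` B|).+1.
Proof.
move=> eA eB; rewrite fsetIUl (fsetIidPl _) ?fsub1set // cardfsU1.
by rewrite inE (negbTE eA).
Qed.

Lemma card_two_sum_basis e M N B1 B2 A1 A2 : ground M `&` ground N = [fset e] ->
  B1 \in bases M -> B2 \in bases N -> A1 `<=` ground M `\ e -> A2 `<=` ground N `\ e ->
  #|` (A1 `|` A2) `&` ((B1 `|` B2) `\ e)| = (#|` A1 `&` B1| + #|` A2 `&` B2|)%N.
Proof.
move=> gE b1 b2 s1 s2.
have gE' : ground N `&` ground M = [fset e] by rewrite fsetIC.
have o1 z : z \in A1 -> z != e /\ (z \notin A2) && (z \notin B2).
  move=> /(fsubsetP s1); rewrite !inE => /andP[ze zM]; split=> //.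
  have zN := notin_other gE ze zM; apply/andP; split; apply: contra zN.
    by move=> /(fsubsetP s2); rewrite inE => /andP[].
  exact/fsubsetP/bases_sub.
have o2 z : z \in A2 -> z != e /\ (z \notin B1).
  move=> /(fsubsetP s2); rewrite !inE => /andP[ze zN]; split=> //.
  apply: contra (notin_other gE' ze zN); exact/fsubsetP/bases_sub.
rewrite -cardfsUI.
have -> : (A1 `&` B1) `&` (A2 `&` B2) = fset0.
  apply/fsetP => z; rewrite !inE; have [/o1[_ /andP[/negbTE-> _]]|//] := boolP (z \in A1).
  by rewrite andbF.
rewrite cardfs0 addn0; congr (size (enum_fset _)).
apply/fsetP => z; rewrite !inE.
have [/o1[-> /andP[/negbTE-> /negbTE->]]|_] := boolP (z \in A1); first by rewrite !orbF.
by have [/o2[-> /negbTE->]|_] := boolP (z \in A2).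
Qed.

(** The two terms correspond to the summand whose basis contains [e]. The successor accounts for
    [e], which is counted in that summand but removed in the 2-sum. *)
Lemma two_sum_rk e M N S A1 A2 : summable e M N -> two_sum_bases e M N S ->
  A1 `<=` ground M `\ e -> A2 `<=` ground N `\ e ->
  (rk S (A1 `|` A2)).+1 =
    maxn (rk M (e |` A1) + rk N A2)%N (rk M A1 + rk N (e |` A2))%N.
Proof.
move=> sMN [_ bS] s1 s2.
have [M1 M0 N1 N0] := summable_bases sMN.
have gE : ground M `&` ground N = [fset e] by case: sMN.
have e1 : e \notin A1 by apply/negP => /(fsubsetP s1); rewrite !inE eqxx.
have e2 : e \notin A2 by apply/negP => /(fsubsetP s2); rewrite !inE eqxx.
apply/eqP; rewrite eqn_leq; apply/andP; split.
  have [Z /bS[B1 [B2 [b1 b2 eB ZE]]] <-] := rk_witness S (A1 `|` A2).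
  rewrite ZE (card_two_sum_basis gE) //.
  have [eB1|eB1] := boolP (e \in B1).
    have := leq_rk (e |` A1) b1; have := leq_rk A2 b2.
    by rewrite card_fsetIU1 //; lia.
  have eB2 : e \in B2 by move: eB; rewrite (negbTE eB1); case: (e \in B2).
  have := leq_rk (e |` A2) b2; have := leq_rk A1 b1.
  by rewrite card_fsetIU1 //; lia.
(* Once it is fixed which basis contains [e], the bases of the two summands can be maximized
   independently. *)
rewrite geq_max; apply/andP; split.
  have [B1 [b1 eB1 <-]] := rk_witness_contain A1 M1.
  have [B2 [b2 eB2 <-]] := rk_witness_avoid e2 N0.
  rewrite card_fsetIU1 // addSn -(card_two_sum_basis gE) // ltnS; apply: leq_rk.
  by apply/bS; exists B1, B2; split => //; rewrite eB1 (negbTE eB2).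
have [B1 [b1 eB1 <-]] := rk_witness_avoid e1 M0.
have [B2 [b2 eB2 <-]] := rk_witness_contain A2 N1.
rewrite card_fsetIU1 // addnS -(card_two_sum_basis gE) // ltnS; apply: leq_rk.
by apply/bS; exists B1, B2; split => //; rewrite eB2 (negbTE eB1).
Qed.

Lemma summable_rk e M N : summable e M N ->
  rk M [fset e] = 1 /\ rk M (ground M `\ e) = rk M (ground M).
Proof.
move=> sMN; have [[B b eB] [B' b' eB'] _ _] := summable_bases sMN.
split.
  apply/eqP; rewrite eqn_leq; have := rkU1 M fset0 e; rewrite fsetU0 rk0 => -> /=.
  have := leq_rk [fset e] b; rewrite (fsetIidPl _) ?fsub1set //.
  by rewrite cardfs1.
rewrite (rk_basis b'); last by rewrite fsubsetD1 eB' (bases_sub b').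
by rewrite (rk_basis b' (bases_sub b')).
Qed.

(** With an empty part in [N], the second term is [rk M A] plus the rank 1 of [e] in [N], and it is
    never exceeded by the first. *)
Lemma two_sum_rkl e M N S A : summable e M N -> two_sum_bases e M N S ->
  A `<=` ground M `\ e -> rk S A = rk M A.
Proof.
move=> sMN bS sA; have [rN _] := summable_rk (summableC sMN).
have := two_sum_rk sMN bS sA (fsub0set _).
rewrite !fsetU0 rN rk0; have := rkU1 M A e; lia.
Qed.

(** Since [e] is not a coloop of [N], deleting it keeps the rank of [N], and the first term of
    [two_sum_rk] dominates. *)
Lemma two_sum_rkUl e M N S A : summable e M N -> two_sum_bases e M N S ->
  A `<=` ground M `\ e ->
  (rk S (A `|` (ground N `\ e))).+1 = (rk M (e |` A) + rk N (ground N))%N.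
Proof.
move=> sMN bS sA; have [_ rN] := summable_rk (summableC sMN).
have [_ eN] := summable_ground sMN.
rewrite (two_sum_rk sMN bS sA (fsubset_refl _)) rN fsetD1K //.
by have := rkS M (fsubsetUr [fset e] A); lia.
Qed.

(** * Decomposition along a 2-separation *)

(* The image of [D `<=` e |` A] in a basis of [M] when [e] stands for [y] and [J]
   is contracted. *)
Definition relabel A J y e D : {fset X} := J `|` [fset z in [fset y] | e \in D] `|` D `&` A.

Lemma in_relabel A J y e D z :
  (z \in relabel A J y e D) = [|| z \in J, (z == y) && (e \in D) | (z \in D) && (z \in A)].
Proof. by rewrite !inE orbA. Qed.

(** This is the contraction of [J] in [M], restricted to [A] and [y], with [y] renamed [e]. Both
    relabelled bases contain [J], so an exchange between them in [M] takes place within [A] and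
    [y]. *)
Lemma exists_relabel_minor M A J y e : y \notin A -> y \notin J -> e \notin A ->
  {in A, forall z, z \notin J} ->
  (exists2 D, D `<=` e |` A & relabel A J y e D \in bases M) ->
  exists N, ground N = e |` A /\
    forall D, D \in bases N <-> D `<=` e |` A /\ relabel A J y e D \in bases M.
Proof.
move=> yA yJ eA AJ [D0 s0 b0].
pose Bs := [fset D in fpowerset (e |` A) | relabel A J y e D \in bases M].
have inBs D : D \in Bs <-> D `<=` e |` A /\ relabel A J y e D \in bases M.
  by rewrite !inE fpowersetE; split=> [/andP[]|[-> ->]].
have Bs_sub D : D \in Bs -> D `<=` e |` A by case/inBs.
have Bs0 : Bs != fset0 by apply/fset0Pn; exists D0; apply/inBs.
have exch D1 D2 x : D1 \in Bs -> D2 \in Bs -> x \in D1 `\` D2 ->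
    exists2 w, w \in D2 `\` D1 & w |` (D1 `\ x) \in Bs.
  move=> /inBs[s1 b1] /inBs[s2 b2]; rewrite inE => /andP[x2 x1].
  have xA : x != e -> x \in A.
    by move=> xe; have := fsubsetP s1 x x1; rewrite in_fset1U (negbTE xe).
  (* The element of [M] that [x] stands for. *)
  pose x' := if x == e then y else x.
  have xD : x' \in relabel A J y e D1 `\` relabel A J y e D2.
    rewrite in_fsetD !in_relabel /x'; have [xe|xe] := eqVneq x e.
      by rewrite -xe x1 (negbTE x2) (negbTE yJ) (negbTE yA) eqxx !andbF.
    have xy : x != y by apply: contraNneq yA => <-; apply: xA.
    by rewrite (negbTE (AJ _ (xA xe))) (negbTE xy) (negbTE x2) x1 xA.
  have [w' + b] := bases_exchange b1 b2 xD.
  rewrite in_fsetD !in_relabel !negb_or => /andP[/and3P[wJ wy wD]].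
  rewrite (negbTE wJ) /= => wD2.
  have [wE|w'y] := eqVneq w' y.
    subst w'; move: wy wD2; rewrite eqxx (negbTE yA) !andbF orbF /= => e1 e2.
    have xe : x != e by apply: contraNneq e1 => <-.
    exists e; first by rewrite inE e1.
    apply/inBs; split.
      rewrite fsubUset fsub1set fset1U1 /=; apply: fsubset_trans s1.
      exact: fsubD1set.
    suff <- : y |` (relabel A J y e D1 `\ x') = relabel A J y e (e |` (D1 `\ x)) by [].
    apply/fsetP => z; rewrite /x' (negbTE xe) in_fset1U in_fsetD1 !in_relabel !inE eqxx.
    have [_|zy] := eqVneq z y; first by rewrite /= orbT.
    have [->|zx] := eqVneq z x.
      by rewrite (negbTE xe) (negbTE (AJ _ (xA xe))) /=.
    have [->|//] := eqVneq z e; by rewrite /= (negbTE eA) !andbF.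
  move: wD2 wD; rewrite (negbTE w'y) /= => /andP[w2 wA]; rewrite wA andbT => w1.
  have we : w' != e by apply: contraNneq eA => <-.
  exists w'; first by rewrite inE w1.
  apply/inBs; split.
    rewrite fsubUset fsub1set in_fset1U wA orbT /=; apply: fsubset_trans s1.
    exact: fsubD1set.
  suff <- : w' |` (relabel A J y e D1 `\ x') = relabel A J y e (w' |` (D1 `\ x)) by [].
  apply/fsetP => z; rewrite /x' in_fset1U in_fsetD1 !in_relabel !inE.
  have [->|zw] := eqVneq z w'; first by rewrite wA /= !orbT.
  rewrite ![e == _]eq_sym (negbTE we) /=; have [xe|xe] := eqVneq x e.
    rewrite xe /= ?andbF ?orbF; have [->|zy] := eqVneq z y.
      by rewrite (negbTE yJ) (negbTE yA) !andbF.
    have [->|//] := eqVneq z e; by rewrite (negbTE eA) !andbF.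
  rewrite /=; have [->|//] := eqVneq z x.
  have xy : x != y by apply: contraNneq yA => <-; apply: xA.
  by rewrite (negbTE (AJ _ (xA xe))) (negbTE xy).
by exists (Matroid Bs_sub Bs0 exch).
Qed.

(** Extend the trace of [Z1] on [A] by [Z2]. That trace is already maximal, so nothing is added in
    [A]; by counting, all of [Z2] outside [A] is added. *)
Lemma bases_mix M A Z1 Z2 : Z1 \in bases M -> Z2 \in bases M ->
  #|` A `&` Z1| = rk M A -> #|` A `&` Z2| = rk M A ->
  A `&` Z1 `|` (Z2 `\` A) \in bases M.
Proof.
move=> b1 b2 r1 r2.
have iI : indep M (A `&` Z1) by exists Z1; rewrite ?fsubsetIr.
have [Z bZ [sI sZ]] := indep_extend iI b2.
have E1 : A `&` Z1 = A `&` Z.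
  by apply/eqP; rewrite eqEfcard fsubsetI fsubsetIl sI r1 leq_rk.
have E2 : Z `\` A = Z2 `\` A.
  apply/eqP; rewrite eqEfcard; apply/andP; split.
    apply/fsubsetP => z; rewrite !inE => /andP[zA /(fsubsetP sZ)].
    by rewrite !inE zA (negbTE zA).
  have := bases_card bZ b2; have := cardfsID A Z; have := cardfsID A Z2.
  rewrite ![_ `&` A]fsetIC -E1 r1 r2; lia.
suff -> : A `&` Z1 `|` (Z2 `\` A) = Z by [].
by rewrite E1 -E2 fsetIC fsetID.
Qed.

(** The summand on [A] with [e] is a minor of [M]: contract a suitable [J] in [B] of rank one less
    than [B], and let a remaining element [y] of [B] play the role of [e]. Its bases without [e] are
    the traces on [A] of bases maximal on [A]; those with [e] come from bases maximal on [B]. *)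
Lemma exists_two_sum_part M A B e :
  ground M = A `|` B -> {in A, forall z, z \notin B} -> e \notin A ->
  (rk M A + rk M B)%N = (mrank M).+1 ->
  exists N, [/\ ground N = e |` A,
    forall Z, Z \in bases M -> #|` A `&` Z| = rk M A -> A `&` Z \in bases N,
    forall Z, Z \in bases M -> #|` B `&` Z| = rk M B -> e |` (A `&` Z) \in bases N,
    forall D, D \in bases N -> e \notin D ->
      exists2 Z, Z \in bases M & A `&` Z = D /\ #|` D| = rk M A
  & forall D, D \in bases N -> e \in D ->
      exists2 Z, Z \in bases M & A `&` Z = D `\ e /\ #|` B `&` Z| = rk M B].
Proof.
move=> gM AB eA rAB.
have [Z0 b0 r0] := rk_witness M A; pose J := Z0 `\` A.
have subM Z z : Z \in bases M -> z \in Z -> z \notin A -> z \in B.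
  by move=> /bases_sub/fsubsetP s /s; rewrite gM inE => /orP[->|].
have sJB : J `<=` B.
  by apply/fsubsetP => z; rewrite inE => /andP[zA /(subM _ _ b0)]; apply.
have AJ : {in A, forall z, z \notin J} by move=> z zA; rewrite inE zA.
have cJ : (rk M A + #|` J|)%N = mrank M.
  by rewrite (mrankE b0) -r0 fsetIC cardfsID.
have iJ : indep M J by exists Z0; rewrite ?fsubsetDl.
have [W bW [sJW rW]] := rk_extend iJ sJB.
(* The rank hypothesis says that [J] has [rk M B - 1] elements, so [W] has exactly one more element
   in [B]. *)
have [y yBW yJ] : exists2 y, y \in B `&` W & y \notin J.
  apply/fsubsetPn; apply/negP => /fsubset_leq_card; lia.
have BWE : B `&` W = y |` J.
  apply/eqP; rewrite eq_sym eqEfcard fsubUset fsub1set yBW fsubsetI sJB sJW /=.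
  by rewrite cardfsU1 yJ rW; lia.
have yB : y \in B by move: yBW; rewrite inE => /andP[].
have yA : y \notin A by apply: contraL yB; apply: AB.
have bas1 Z : Z \in bases M -> #|` A `&` Z| = rk M A ->
    relabel A J y e (A `&` Z) \in bases M.
  move=> bZ rZ; have := bases_mix bZ b0 rZ r0.
  suff -> : A `&` Z `|` (Z0 `\` A) = relabel A J y e (A `&` Z) by [].
  apply/fsetP => z; rewrite in_relabel !inE (negbTE eA) andbF /=.
  by case: (z \in A); case: (z \in Z); case: (z \in Z0).
have bas2 Z : Z \in bases M -> #|` B `&` Z| = rk M B ->
    relabel A J y e (e |` (A `&` Z)) \in bases M.
  move=> bZ rZ; have := bases_mix bW bZ rW rZ; rewrite BWE.
  suff -> : y |` J `|` (Z `\` B) = relabel A J y e (e |` (A `&` Z)) by [].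
  apply/fsetP => z; rewrite in_relabel fset1U1 andbT.
  rewrite !(in_fsetU, in_fsetD, in_fsetI, in_fset1) [X in X || _ = _]orbC -!orbA.
  do 2!congr (_ || _).
  have [zA|zA] := boolP (z \in A).
    by rewrite (AB z zA) /= !andbT; case: eqVneq => // ze; rewrite -ze zA in eA.
  rewrite andbF; apply/negbTE; apply/andP => -[zB zZ].
  by rewrite (subM _ _ bZ zZ zA) in zB.
have [|N [gN bN]] := @exists_relabel_minor M A J y e yA yJ eA AJ.
  exists (A `&` Z0); last exact: bas1.
  by apply: fsubset_trans (fsubsetUr _ _); apply: fsubsetIl.
exists N; split=> //.
- move=> Z bZ rZ; apply/bN; split; last exact: bas1.
  by apply: fsubset_trans (fsubsetUr _ _); apply: fsubsetIl.
- move=> Z bZ rZ; apply/bN; split; last exact: bas2.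
  by apply: fsetUS; apply: fsubsetIl.
- move=> D /bN[sD bD] eD; exists (relabel A J y e D) => //.
  have sDA : D `<=` A.
    apply/fsubsetP => z zD; have := fsubsetP sD z zD; rewrite in_fset1U.
    by case: eqVneq => // ze; rewrite -ze zD in eD.
  have E1 : A `&` relabel A J y e D = D.
    apply/fsetP => z; rewrite in_fsetI in_relabel (negbTE eD) andbF /=.
    have [zA|zA] := boolP (z \in A); first by rewrite (negbTE (AJ z zA)) andbT.
    by apply/esym/negbTE; apply: contra zA; apply: (fsubsetP sDA).
  split=> //; have := mrankE bD; rewrite -(cardfsID A) fsetIC E1.
  have -> : relabel A J y e D `\` A = J.
    apply/fsetP => z; rewrite in_fsetD in_relabel (negbTE eD) andbF /=.
    have [zA|zA] := boolP (z \in A); first by rewrite (negbTE (AJ z zA)).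
    by rewrite andbF orbF.
  lia.
move=> D /bN[sD bD] eD; exists (relabel A J y e D) => //; split.
  apply/fsetP => z; rewrite in_fsetI in_relabel in_fsetD1 eD andbT.
  have [zA|zA] := boolP (z \in A).
    rewrite (negbTE (AJ z zA)) andbT /=.
    have -> : z != e by apply: contraNneq eA => <-.
    by case: eqVneq => // zy; rewrite -zy zA in yA.
  apply/esym/negbTE/andP => -[ze /(fsubsetP sD)].
  by rewrite in_fset1U (negbTE ze) (negbTE zA).
suff -> : B `&` relabel A J y e D = B `&` W by [].
rewrite BWE; apply/fsetP => z.
rewrite in_fsetI in_relabel eD andbT in_fset1U [RHS]orbC.
have [zB|zB] := boolP (z \in B).
  have /negbTE-> : z \notin A by apply: contraL zB; apply: AB.
  by rewrite andbF orbF.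
apply/esym/negbTE; rewrite negb_or; apply/andP; split.
  by apply: contra zB; apply: (fsubsetP sJB).
by apply: contraNneq zB => ->.
Qed.

(** By the rank hypothesis every basis of [S] is maximal on exactly one of [A] and [B] and falls one
    short on the other; [e] is added to the short part. Conversely, two parts that disagree at [e]
    are glued by [bases_mix]. *)
Lemma exists_two_sum_decomposition S A B e :
  ground S = A `|` B -> {in A, forall z, z \notin B} -> e \notin A -> e \notin B ->
  A != fset0 -> B != fset0 -> (rk S A + rk S B)%N = (mrank S).+1 ->
  exists M N, [/\ ground M = e |` A, ground N = e |` B, summable e M N
                & two_sum_bases e M N S].
Proof.
move=> gS AB eA eB A0 B0 rAB.
have BA : {in B, forall z, z \notin A}.
  by move=> z zB; apply/negP => /AB; rewrite zB.
have [M [gM M1 M2 M3 M4]] := exists_two_sum_part gS AB eA rAB.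
have [N [gN N1 N2 N3 N4]] : exists N, _ :=
  exists_two_sum_part (etrans gS (fsetUC A B)) BA eB (etrans (addnC _ _) rAB).
have cardZ Z : Z \in bases S -> (#|` A `&` Z| + #|` B `&` Z|)%N = mrank S.
  move=> bZ; rewrite (mrankE bZ) -(cardfsID A Z) [A `&` Z]fsetIC.
  congr (_ + size (enum_fset _))%N; apply/fsetP => z; rewrite !inE.
  have [zB|zB] := boolP (z \in B); first by rewrite BA.
  have [zA|zA] := boolP (z \in A) => //=; apply/esym/negbTE.
  apply/negP => /(fsubsetP (bases_sub bZ)); rewrite gS inE.
  by rewrite (negbTE zA) (negbTE zB).
(* Traces of [Za] and [Zb] supply bases with and without [e] in both summands, so [e] is neither a
   loop nor a coloop. *)
have [Za ba ra] := rk_witness S A; have [Zb bb rb] := rk_witness S B.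
have card2 C : C != fset0 -> e \notin C -> 2 <= #|` e |` C|.
  by rewrite -cardfs_gt0 cardfsU1 => C0 ->.
have eIA Z : e \notin A `&` Z by rewrite inE (negbTE eA).
have eIB Z : e \notin B `&` Z by rewrite inE (negbTE eB).
have eM : e \in ground M by rewrite gM fset1U1.
have eN : e \in ground N by rewrite gN fset1U1.
exists M, N; split=> //.
  split; [by rewrite gM card2 | by rewrite gN card2 | | |].
  - rewrite gM gN -fsetUIr; apply/fsetP => z; rewrite !inE.
    have [/AB/negbTE->|_] := boolP (z \in A); by rewrite ?andbF ?orbF.
  - split; first by apply/(not_loopP eM); exists (e |` (A `&` Zb)); rewrite ?fset1U1 ?M2.
    by apply/(not_coloopP eM); exists (A `&` Za); rewrite ?M1.
  - split; first by apply/(not_loopP eN); exists (e |` (B `&` Za)); rewrite ?fset1U1 ?N2.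
    by apply/(not_coloopP eN); exists (B `&` Zb); rewrite ?N1.
split=> [|Z].
  rewrite gS gM gN -fsetUUr fsetU1K // inE negb_or eA eB //.
have ZE Z' : Z' \in bases S -> Z' = (A `&` Z') `|` (B `&` Z').
  by move=> /bases_sub sZ; rewrite -fsetIUl -gS; apply/esym/fsetIidPr.
split=> [bZ|[B1 [B2 [b1 b2 eB12 ->]]]].
  have := cardZ Z bZ; have := leq_rk A bZ; have := leq_rk B bZ => lB lA cZ.
  have eZ : e \notin Z by rewrite (ZE _ bZ) inE negb_or eIA eIB.
  have [rA|rA] := eqVneq #|` A `&` Z| (rk S A).
    exists (A `&` Z), (e |` (B `&` Z)); split; [exact: M1|exact: N2| |].
      by rewrite fset1U1 (negbTE (eIA Z)).
    by rewrite fsetUCA -(ZE _ bZ) fsetU1K.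
  have rB : #|` B `&` Z| = rk S B by lia.
  exists (e |` (A `&` Z)), (B `&` Z); split; [exact: M2|exact: N1| |].
    by rewrite fset1U1 (negbTE (eIB Z)).
  by rewrite -fsetUA -(ZE _ bZ) fsetU1K.
have diffA Z' : Z' \in bases S -> Z' `\` A = B `&` Z'.
  move=> bZ; rewrite {1}(ZE _ bZ); apply/fsetP => z; rewrite !inE.
  have [zB|zB] := boolP (z \in B); first by rewrite (negbTE (BA z zB)).
  by rewrite /= orbF; case: (z \in A).
have diffB Z' : Z' \in bases S -> Z' `\` B = A `&` Z'.
  move=> bZ; rewrite {1}(ZE _ bZ); apply/fsetP => z; rewrite !inE.
  have [zA|zA] := boolP (z \in A); first by rewrite (negbTE (AB z zA)) orbF.
  by case: (z \in B).
have [e1|e1] := boolP (e \in B1).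
  have e2 : e \notin B2 by move: eB12; rewrite e1; case: (e \in B2).
  have [Z1 z1 [E1 r1]] := M4 _ b1 e1; have [Z2 z2 [E2 r2]] := N3 _ b2 e2.
  rewrite -E2 in r2; have := bases_mix z2 z1 r2 r1.
  rewrite (diffB _ z1) E1 E2 fsetDUl (_ : B2 `\ e = B2) 1?fsetUC //.
  by apply/fsetP => z; rewrite !inE; case: eqVneq => // ->; rewrite (negbTE e2).
have e2 : e \in B2 by move: eB12; rewrite (negbTE e1); case: (e \in B2).
have [Z1 z1 [E1 r1]] := N4 _ b2 e2; have [Z2 z2 [E2 r2]] := M3 _ b1 e1.
rewrite -E2 in r2; have := bases_mix z2 z1 r2 r1.
rewrite (diffA _ z1) E1 E2 fsetDUl (_ : B1 `\ e = B1) //.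
by apply/fsetP => z; rewrite !inE; case: eqVneq => // ->; rewrite (negbTE e1).
Qed.

End Matroids.

(** * Cyclic orders and necklaces *)

Section CyclicOrder.
Variables (d : Order.disp_t) (X : orderType d).
Implicit Types (a b c e v w x y z : X).

(* Any statement about the order of finitely many points can be checked in [nat]. *)
Lemma order_embed (s : seq X) :
  exists f : X -> nat, forall x y, x \in s -> y \in s -> (x <= y)%O = (f x <= f y).
Proof.
exists (fun x => count (fun z => z < x)%O s) => x y xs ys.
have [le_xy|lt_yx] := leP x y; apply/esym.
  by apply: sub_count => z /= /lt_le_trans; apply.
apply/negbTE; rewrite -ltnNge.
have -> : count (fun z => z < x)%O s =
    count (fun z => z < y)%O s + count (fun z => y <= z < x)%O s.
  rewrite -count_predUI [X in _ = _ + X](@eq_count _ _ pred0) ?count_pred0 ?addn0.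
    apply: eq_count => z /=; have [zy|yz] := ltP z y => //=.
    by rewrite (lt_trans zy).
  by move=> z /=; have [|] := ltP z y.
by rewrite -[ltnLHS]addn0 ltn_add2l -has_count; apply/hasP; exists y; rewrite ?lexx.
Qed.

(** Moves all comparisons to [nat] along [f] and splits on each; [lia] refutes the inconsistent
    cases. *)
Ltac cyc_cases f fE :=
  rewrite /cyc_le !fE ?inE ?eqxx ?orbT //;
  repeat match goal with |- context [f ?a <= f ?b] => case: (leqP (f a) (f b)) => ? end;
  by [] || (exfalso; lia).

Lemma cyc_le_total w : total (cyc_le w).
Proof.
move=> x y; have [f fE] := order_embed [:: w; x; y].
cyc_cases f fE.
Qed.

Lemma cyc_le_refl w : reflexive (cyc_le w).
Proof. by move=> x; have := cyc_le_total w x x; rewrite orbb. Qed.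

Lemma cyc_le_trans w : transitive (cyc_le w).
Proof.
move=> y x z; have [f fE] := order_embed [:: w; x; y; z].
cyc_cases f fE.
Qed.

Lemma cyc_le_anti w : antisymmetric (cyc_le w).
Proof.
move=> x y; have [f fE] := order_embed [:: w; x; y].
move=> H; apply/eqP; rewrite eq_le; move: H.
cyc_cases f fE.
Qed.

Lemma cyc_le_base w x : cyc_le w w x.
Proof.
have [f fE] := order_embed [:: w; x].
cyc_cases f fE.
Qed.

(** Change of base point: seen from [e], the segment from [w] to [x] is an interval if [w] comes
    before [x], and otherwise wraps around as a final segment together with an initial one. *)
Lemma cyc_le_shift e w z x : cyc_le w z x =
  if cyc_le e w x then cyc_le e w z && cyc_le e z x else cyc_le e w z || cyc_le e z x.
Proof.
have [f fE] := order_embed [:: e; w; x; z].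
cyc_cases f fE.
Qed.

End CyclicOrder.

(** * Lexicographic comparison of sorted sequences *)

Section LexMin.
Variables (T : eqType) (r : rel T).
Hypotheses (r_total : total r) (r_trans : transitive r) (r_anti : antisymmetric r).

Lemma seq_lex_total : total (seq_lex r).
Proof.
elim=> [|x s IHs] [|y t] //=; rewrite [y == x]eq_sym.
by case: eqP.
Qed.

Lemma seq_lex_trans : transitive (seq_lex r).
Proof.
move=> t s; elim: s t => [|x s IHs] [|y t] [|z u] //=.
have [<-|xy] := eqVneq x y; first by case: eqP => // _; apply: IHs.
have [<-|yz] := eqVneq y z; first by rewrite (negbTE xy).
have [<-|_] := eqVneq x z; last exact: r_trans.
move=> rxy ryx; have exy : x = y by apply: r_anti; rewrite rxy.
by rewrite exy eqxx in xy.
Qed.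

Lemma head_sortP x0 (s : seq T) : s != [::] ->
  head x0 (sort r s) \in s /\ forall y, y \in s -> r (head x0 (sort r s)) y.
Proof.
move=> s0; have := sort_sorted r_total s; have := mem_sort r s.
have := size_sort r s; case: (sort r s) => [|x t] /=.
  by move=> /esym/size0nil s00; rewrite s00 in s0.
move=> _ mE /(order_path_min r_trans)/allP tP; split; first by rewrite -mE inE eqxx.
move=> y; rewrite -mE inE => /predU1P[->|/tP//].
by have := r_total x x; rewrite orbb.
Qed.

(** At the first difference, let [s] have [x] and [t] have [y]. If [x] came before [y], it would
    come before [b] and so belong to [t], whose least remaining element is [y]; this forces
    [x = y]. *)
Lemma seq_lex_first s t b : sorted r s -> sorted r t -> uniq s -> size s = size t ->
  b \in t -> b \notin s -> (forall z, z \in s -> r z b -> z \in t) -> ~~ seq_lex r s t.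
Proof.
elim: s t => [|x s IHs] [|y t] //= ps pt /andP[xs us] [st] bt bs sub.
have [exy|xy] := eqVneq x y.
  subst y; move: bs; rewrite inE negb_or => /andP[bx bs].
  move: bt; rewrite inE (negbTE bx) /= => bt.
  apply: IHs => //; [exact: path_sorted ps | exact: path_sorted pt |].
  move=> z zs rzb; have := sub z; rewrite !inE zs orbT => /(_ isT rzb).
  by have [zx|] := eqVneq z x; first by rewrite -zx zs in xs.
have yP z : z \in y :: t -> r y z.
  rewrite inE => /predU1P[->|]; first by have := r_total y y; rewrite orbb.
  by move: z; apply/allP/(order_path_min r_trans).
apply/negP => rxy; have rxb : r x b by apply: r_trans rxy (yP _ bt).
have /yP ryx := sub x (mem_head _ _) rxb.
by case/eqP: xy; apply: r_anti; rewrite rxy.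
Qed.

End LexMin.

(** * Necklaces and ranks of cyclic intervals *)

Section Necklace.
Local Open Scope fset_scope.
Variables (d : Order.disp_t) (X : orderType d).
Implicit Types (M P : matroid X) (A B E I J : {fset X}) (a b c e v w x y z : X).

(** The cyclic interval from [w] to [x], seen as an initial segment of the order starting at [w]. *)
Definition cyc_arc E w x : {fset X} := [fset z in E | cyc_le w z x].

Lemma in_cyc_arc E w x z : (z \in cyc_arc E w x) = (z \in E) && cyc_le w z x.
Proof. by rewrite !inE. Qed.

Lemma fset_lex_total w : total (@fset_lex d X w).
Proof. by move=> A B; apply/seq_lex_total/cyc_le_total. Qed.

Lemma fset_lex_trans w : transitive (@fset_lex d X w).
Proof.
move=> A B C; apply: seq_lex_trans; [exact: cyc_le_trans | exact: cyc_le_anti].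
Qed.

Lemma lexmin_basisP M w : lexmin_basis M w \in bases M /\
  forall B, B \in bases M -> fset_lex w (lexmin_basis M w) B.
Proof.
apply: head_sortP; [exact: fset_lex_total | exact: fset_lex_trans |].
have [B bB] := fset0Pn _ (bases_neq0 M).
by apply/eqP => E0; move: bB; rewrite -[_ \in _]/(B \in (bases M : seq _)) E0.
Qed.

(** Otherwise the trace of the least basis on the arc extends to a basis [B] containing a new
    element [b] of the arc. Every element of the least basis before [b] lies in [B], so [B] would be
    smaller by [seq_lex_first]. *)
Lemma lexmin_basis_greedy M w x :
  #|` cyc_arc (ground M) w x `&` lexmin_basis M w| = rk M (cyc_arc (ground M) w x).
Proof.
set S := cyc_arc _ _ _; set J := lexmin_basis M w; have [bJ minJ] := lexmin_basisP M w.
have iI : indep M (S `&` J) by exists J; rewrite ?fsubsetIr.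
have [B bB [sB rB]] := rk_extend iI (fsubsetIl _ _).
apply/eqP; rewrite eqn_leq leq_rk //= -rB leqNgt; apply/negP => lt.
have [b /[!inE]/andP[bS bB'] nJ] : exists2 b, b \in S `&` B & b \notin J.
  apply/fsubsetPn; apply: contraTN lt => sJ; rewrite -leqNgt.
  by apply: fsubset_leq_card; rewrite fsubsetI fsubsetIl.
have := minJ B bB; apply/negP; apply: (@seq_lex_first _ _ _ _ _ _ _ b).
- exact: cyc_le_total.
- exact: cyc_le_trans.
- exact: cyc_le_anti.
- exact/sort_sorted/cyc_le_total.
- exact/sort_sorted/cyc_le_total.
- by rewrite sort_uniq fset_uniq.
- by rewrite !size_sort (bases_card bJ bB).
- by rewrite mem_sort.
- by rewrite mem_sort.
move=> z; rewrite !mem_sort => zJ zb; apply: (fsubsetP sB).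
have zM := fsubsetP (bases_sub bJ) z zJ.
move: bS; rewrite inE zJ andbT !in_cyc_arc zM /= => /andP[_]; exact: cyc_le_trans zb.
Qed.

Lemma lexmin_basis_unique E w J J' : J `<=` E -> J' `<=` E ->
  (forall x, x \in E -> #|` cyc_arc E w x `&` J| = #|` cyc_arc E w x `&` J'|) -> J = J'.
Proof.
move=> sJ sJ' H.
(* Induction on the size of the arc ending at [x]: once the traces before [x] agree, equal counts
   decide the membership of [x]. *)
have main n x : x \in E -> #|` cyc_arc E w x| <= n -> (x \in J) = (x \in J').
  elim: n x => [|n IHn] x xE.
    rewrite leqn0 cardfs_eq0 => /eqP arc0.
    by have := in_cyc_arc E w x x; rewrite arc0 xE cyc_le_refl inE.
  move=> le_n; have := H x xE.
  have split K : #|` cyc_arc E w x `&` K| = ((x \in K) + #|` (cyc_arc E w x `\ x) `&` K|)%N.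
    rewrite (cardfsD1 x) in_fsetI in_cyc_arc xE cyc_le_refl /=.
    by rewrite fsetIDAC.
  rewrite !split; suff -> : (cyc_arc E w x `\ x) `&` J = (cyc_arc E w x `\ x) `&` J'.
    by case: (x \in J); case: (x \in J') => //; lia.
  apply/fsetP => z; rewrite !in_fsetI in_fsetD1 in_cyc_arc.
  case: eqVneq => //= zx; have [zE|//] := boolP (z \in E).
  case: (boolP (cyc_le w z x)) => //= zwx; apply: IHn => //.
  rewrite -ltnS; apply: leq_trans le_n; apply: (@card_fset_ltn _ _ _ x).
  - apply/fsubsetP => y; rewrite !in_cyc_arc => /andP[-> yz] /=.
    exact: cyc_le_trans yz zwx.
  - by rewrite in_cyc_arc xE cyc_le_refl.
  - rewrite in_cyc_arc xE /=; apply: contra zx => xz.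
    by apply/eqP; apply: (@cyc_le_anti _ _ w); rewrite zwx.
apply/fsetP => x; have [xE|nE] := boolP (x \in E); first exact: main (leqnn _).
by apply/idP/idP => [/(fsubsetP sJ)|/(fsubsetP sJ')]; rewrite (negbTE nE).
Qed.

Lemma necklace_arcP M P : ground M = ground P ->
  necklace M = necklace P <->
  forall w x, w \in ground M -> rk M (cyc_arc (ground M) w x) = rk P (cyc_arc (ground M) w x).
Proof.
rewrite /necklace => gE; split=> [neq w x wM|H].
  have wS : w \in sorted_elts (ground M) by rewrite mem_sort.
  have lE : lexmin_basis M w = lexmin_basis P w.
    by rewrite -gE in neq; move/eq_in_map: neq; apply.
  by rewrite -lexmin_basis_greedy lE gE lexmin_basis_greedy.
rewrite -gE; apply/eq_in_map => w; rewrite mem_sort => wM.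
apply: (@lexmin_basis_unique (ground M) w).
- by apply: bases_sub; have [] := lexmin_basisP M w.
- by rewrite gE; apply: bases_sub; have [] := lexmin_basisP P w.
by move=> x _; rewrite lexmin_basis_greedy (H w x wM) gE lexmin_basis_greedy.
Qed.

(** Cyclic intervals of [E] that do not wrap around past [v]. *)
Definition cyc_convex v E I : Prop := I `<=` E /\
  forall a b c, a \in I -> b \in E -> c \in I -> cyc_le v a b -> cyc_le v b c -> b \in I.

Lemma fset_least (r : rel X) I : total r -> transitive r -> I != fset0 ->
  exists2 w, w \in I & forall z, z \in I -> r w z.
Proof.
move=> r_total r_trans /fset0Pn[x xI].
have [|wI wP] := head_sortP r_total r_trans x (s := I).
  by apply/eqP => I0; move: xI; rewrite -[_ \in _]/(x \in (I : seq _)) I0.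
by exists (head x (sort r I)).
Qed.

Lemma fset_cyc_max v I : I != fset0 ->
  exists2 x, x \in I & forall z, z \in I -> cyc_le v z x.
Proof.
apply: (@fset_least (fun x y => cyc_le v y x)) => [x y|y x z xy yz].
  exact: cyc_le_total.
exact: cyc_le_trans yz xy.
Qed.

Lemma cyc_convex_arc v E I : cyc_convex v E I ->
  I = fset0 \/ exists w x, w \in E /\ I = cyc_arc E w x.
Proof.
case=> sI cI; have [|I0] := eqVneq I fset0; [by left | right].
have [w wI wP] := fset_least (cyc_le_total v) (@cyc_le_trans _ _ v) I0.
have [x xI xP] := fset_cyc_max v I0.
exists w, x; split; first exact: (fsubsetP sI).
apply/fsetP => z; rewrite in_cyc_arc (cyc_le_shift v) wP //.
apply/idP/idP => [zI|/and3P[zE wz zx]]; first by rewrite (fsubsetP sI) ?wP ?xP.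
exact: cI wz zx.
Qed.

Lemma cyc_convexC e E I : cyc_convex e E I -> exists v, cyc_convex v E (E `\` I).
Proof.
case=> sI cI; have [->|I0] := eqVneq I fset0.
  by exists e; rewrite fsetD0; split.
(* Starting the order at the last element of [I] puts the complement into one piece. *)
have [v vI vP] := fset_cyc_max e I0; exists v; split; first exact: fsubsetDl.
move=> a b c; rewrite !inE => /andP[aI _] bE /andP[cI' cE] ab bc.
rewrite bE andbT; apply/negP => bI; case/negP: cI'.
have [eq_bv|bv] := eqVneq b v.
  case/negP: aI; suff -> : a = v by [].
  by apply: (@cyc_le_anti _ _ v); rewrite cyc_le_base andbT -{2}eq_bv.
have be := vP b bI; move: bc; rewrite (cyc_le_shift e).
have [vc|cv] := boolP (cyc_le e v c).
  by case/andP => vb _; case/eqP: bv; apply: (@cyc_le_anti _ _ e); rewrite be.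
case/orP => [vb|bc]; first by case/eqP: bv; apply: (@cyc_le_anti _ _ e); rewrite be.
apply: (cI b c v) => //; by have := cyc_le_total e v c; rewrite (negbTE cv).
Qed.

Lemma arc_cyc_convex e E w x :
  cyc_convex e E (cyc_arc E w x) \/ cyc_convex e E (E `\` cyc_arc E w x).
Proof.
have [wx|xw] := boolP (cyc_le e w x); [left|right]; split.
- by apply/fsubsetP => z; rewrite in_cyc_arc => /andP[].
- move=> a b c; rewrite !in_cyc_arc (cyc_le_shift e w a x)
    (cyc_le_shift e w b x) (cyc_le_shift e w c x) wx.
  move=> /and3P[_ wa _] -> /and3P[_ _ cx] ab bc /=.
  by rewrite (cyc_le_trans wa ab) (cyc_le_trans bc cx).
- exact: fsubsetDl.
move=> a b c; rewrite !in_fsetD !in_cyc_arc (cyc_le_shift e w a x)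
  (cyc_le_shift e w b x) (cyc_le_shift e w c x) (negbTE xw).
case/andP => + aE bE /andP[+ cE]; rewrite aE bE cE /= !negb_or andbT.
move=> /andP[_ ax] /andP[wc _] ab bc; apply/andP; split.
  by apply: contra wc => wb; apply: cyc_le_trans bc.
by apply: contra ax => bx; apply: cyc_le_trans bx.
Qed.

(** An arc either wraps around past [e] or does not, so the convex sets for the single base point
    [e] and their complements replace the arcs from all starting points. *)
Lemma necklace_convexP e M P : ground M = ground P ->
  necklace M = necklace P <->
  forall I, cyc_convex e (ground M) I ->
    rk M I = rk P I /\ rk M (ground M `\` I) = rk P (ground M `\` I).
Proof.
move=> gE; split=> [/(necklace_arcP gE) H|H].
  have convH v I : cyc_convex v (ground M) I -> rk M I = rk P I.
    by case/cyc_convex_arc => [->|[w [x [wM ->]]]]; [rewrite !rk0 | apply: H].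
  move=> I cI; split; first exact: convH cI.
  by have [v /convH] := cyc_convexC cI.
apply/(necklace_arcP gE) => w x _.
have [/H[]//|/H[_]] := arc_cyc_convex e (ground M) w x.
suff -> : ground M `\` (ground M `\` cyc_arc (ground M) w x) = cyc_arc (ground M) w x by [].
by rewrite fsetDK //; apply/fsubsetP => z; rewrite in_cyc_arc => /andP[].
Qed.

End Necklace.

(** * Envelopes of 2-sums *)

Section Envelopes.
Local Open Scope fset_scope.
Variables (d : Order.disp_t) (X : orderType d).
Implicit Types (M N P Q S : matroid X) (A B E I : {fset X}) (a b c e x y z : X).

(** A loop or coloop [e] would be split off from the remaining elements by a 1-separation. *)
Lemma connected_not_loop_coloop M e : tutte_connected 2 M -> 2 <= #|` ground M| ->
  e \in ground M -> ~ loop M e /\ ~ coloop M e.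
Proof.
move=> conn cM eM.
have nsep : ~ rk M [fset e] + rk M (ground M `\ e) < mrank M + 1.
  move=> lt; apply: (conn 1 [fset e] (ground M `\ e)) => //; split=> //.
  - exact: fsetD1K.
  - by apply/fdisjointP => z /fset1P->; rewrite !inE eqxx.
  - by rewrite cardfs1.
  - by move: cM; rewrite (cardfsD1 e) eM.
have [B bB] := fset0Pn _ (bases_neq0 M).
split=> -[_ H]; apply: nsep.
  have -> : rk M [fset e] = 0.
    have [B' b' <-] := rk_witness M [fset e]; apply/eqP; rewrite cardfs_eq0.
    apply/eqP/fsetP => z; rewrite !inE; case: eqVneq => // ->.
    by rewrite (negbTE (H B' b')).
  by rewrite add0n addn1 ltnS; apply/rkS/fsubD1set.
have := rkU1 M fset0 e; rewrite fsetU0 rk0.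
have [B' b' <-] := rk_witness M (ground M `\ e).
have := cardfsD1 e B'; rewrite (H B' b') (mrankE b').
have -> : (ground M `\ e) `&` B' = B' `\ e.
  by rewrite fsetIDAC; congr (_ `\ _); apply/fsetIidPr/bases_sub.
lia.
Qed.

(** Being neither a loop nor a coloop is visible in the ranks of [e], of the ground set, and of the
    ground set without [e]. *)
Lemma rk_summable e M N P Q : summable e P Q -> ground M = ground P -> ground N = ground Q ->
  rk M [fset e] = rk P [fset e] -> rk N [fset e] = rk Q [fset e] ->
  rk M (ground P `\ e) = rk P (ground P `\ e) -> rk M (ground P) = rk P (ground P) ->
  rk N (ground Q `\ e) = rk Q (ground Q `\ e) -> rk N (ground Q) = rk Q (ground Q) ->
  summable e M N.
Proof.
move=> sPQ gM gN.
have [rP rP'] := summable_rk sPQ; have [rQ rQ'] := summable_rk (summableC sPQ).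
have [eP eQ] := summable_ground sPQ.
have main K E : e \in ground K -> ground K = E -> rk K [fset e] = 1 ->
    rk K (E `\ e) = rk K E -> ~ loop K e /\ ~ coloop K e.
  move=> eK gK re rE; split.
    apply/(not_loopP eK); have [B bB] := rk_witness K [fset e]; rewrite re => cB.
    exists B => //; apply: (contraPT _ cB) => eB.
    suff -> : [fset e] `&` B = fset0 by rewrite cardfs0.
    by apply/fsetP => z; rewrite !inE; case: eqVneq => // ->; rewrite (negbTE eB).
  apply/(not_coloopP eK); have [B bB H] := rk_witness K (E `\ e); exists B => //.
  apply/negP => eB; have := cardfsD1 e B; rewrite eB.
  have -> : B `\ e = (E `\ e) `&` B.
    by rewrite fsetIDAC; congr (_ `\ _); apply/esym/fsetIidPr; rewrite -gK bases_sub.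
  by rewrite H rE -gK (rk_basis bB (bases_sub bB)); lia.
rewrite rP rQ => rM rN; rewrite rP' rQ' => rM' rM'' rN' rN''.
case: sPQ => cP cQ gE _ _; split; rewrite ?gM ?gN //.
  by apply: (main _ _ _ gM); rewrite ?gM // rM' rM''.
by apply: (main _ _ _ gN); rewrite ?gN // rN' rN''.
Qed.

Lemma cyc_convex0 e E : cyc_convex e E fset0.
Proof. by split. Qed.

Lemma cyc_convex_refl e E : cyc_convex e E E.
Proof. by split. Qed.

Lemma cyc_convexI e E A I : A `<=` E -> cyc_convex e E I -> cyc_convex e A (I `&` A).
Proof.
move=> /fsubsetP sA [sI cI]; split=> [|a b c]; first exact: fsubsetIr.
rewrite !inE => /andP[aI _] bA /andP[cI' _] ab bc; rewrite bA andbT.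
by apply: (cI a b c) => //; apply: sA.
Qed.

(* Since [e] is the least element for [cyc_le e], a cyclic interval of [ground M]
   either avoids [e] and is convex, or contains [e] and has a convex complement. *)
Lemma necklace_convexD1 e M P : ground M = ground P -> e \in ground M ->
  necklace M = necklace P <->
  forall I, cyc_convex e (ground M `\ e) I ->
    rk M I = rk P I /\
    rk M (e |` (ground M `\ e `\` I)) = rk P (e |` (ground M `\ e `\` I)).
Proof.
move=> gE eM; have compl I : I `<=` ground M `\ e ->
    e |` (ground M `\ e `\` I) = ground M `\` I.
  move=> sI; apply/fsetP => z; rewrite !inE; case: eqVneq => // ->.
  rewrite /= eM andbT; apply/esym/negP => eI.
  by have := fsubsetP sI e eI; rewrite !inE eqxx.
rewrite (necklace_convexP e gE); split=> H I [sI cI].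
  rewrite compl //; apply: H; split; first exact: fsubset_trans sI (fsubD1set _ _).
  move=> a b c aI bE cI' ab bc; apply: (cI a b c) => //; rewrite !inE bE andbT.
  apply: (contraTneq _ (fsubsetP sI a aI)) => be; rewrite !inE negb_and negbK.
  by apply/orP; left; apply/eqP/(@cyc_le_anti _ _ e); rewrite cyc_le_base -{2}be ab.
have [eI|eI] := boolP (e \in I); last first.
  rewrite -compl ?fsubsetD1 ?sI //; apply: H; split; first by rewrite fsubsetD1 sI.
  by move=> a b c aI /[!inE]/andP[_ bE]; apply: cI aI bE.
have cC : cyc_convex e (ground M `\ e) (ground M `\` I).
  split=> [|a b c].
    apply/fsubsetP => z; rewrite !inE => /andP[zI ->]; rewrite andbT.
    by apply: contraNneq zI => ->.
  rewrite !inE => /andP[aI aE] /andP[_ bE] /andP[_ _] ab _; rewrite bE andbT.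
  apply: contra aI => bI; exact: cI eI aE bI (cyc_le_base _ _) ab.
have [r1 r2] := H _ cC; split=> //; rewrite compl in r2; last by case: cC.
by move: r2; rewrite fsetDK.
Qed.

Definition cyc_separated e A B : Prop :=
  (forall a b, a \in A -> b \in B -> cyc_le e a b) \/
  (forall a b, a \in A -> b \in B -> cyc_le e b a).

Lemma cyc_separatedC e A B : cyc_separated e A B -> cyc_separated e B A.
Proof. by case=> H; [right|left] => b a bB aA; apply: H. Qed.

Lemma noncrossing_separated A B e : A `&` B = [fset e] -> noncrossing A B ->
  cyc_separated e (A `\ e) (B `\ e).
Proof.
move=> AB nc; have [eA eB] : e \in A /\ e \in B by apply/andP; rewrite -in_fsetI AB inE.
have neq a b : a \in A `\ e -> b \in B `\ e -> a != b.
  rewrite !inE => /andP[ae aA] /andP[be bB]; apply: contra ae => /eqP ab.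
  by rewrite -in_fset1 -AB inE aA ab bB.
have ltN a b : ~~ cyc_le e b a -> cyc_le e a b.
  by have := cyc_le_total e a b; case: (cyc_le e b a); rewrite ?orbF.
apply: contrapT => ns.
have [a [b [aA bB ab]]] : exists a b, [/\ a \in A `\ e, b \in B `\ e & ~~ cyc_le e a b].
  apply: contrapT => H; apply: ns; left=> a b aA bB.
  by apply: contrapT => /negP ab; apply: H; exists a, b.
have [a' [b' [aA' bB' ab']]] :
    exists a b, [/\ a \in A `\ e, b \in B `\ e & ~~ cyc_le e b a].
  apply: contrapT => H; apply: ns; right=> a' b' aA' bB'.
  by apply: contrapT => /negP ab'; apply: H; exists a', b'.
have [ba ab'2] := (ltN _ _ ab, ltN _ _ ab').
have n1 := neq _ _ aA bB; have n2 := neq _ _ aA' bB'; have n3 := neq _ _ aA' bB.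
move: aA bB aA' bB'; rewrite !inE => /andP[ae aA] /andP[be bB] /andP[ae' aA'] /andP[be' bB'].
(* Now [b] precedes [a] and [a'] precedes [b']. Since [e] is in both sets, it serves as the fourth
   point: last in the crossing [a'], [b], [a], [e], or first in [e], [b], [a'], [b']. *)
apply: nc; have [a'b|ba'] := boolP (cyc_le e a' b).
  exists a', b, a, e; split; first by split.
  rewrite /cyc_lt n3 [b == a]eq_sym n1 ae cyc_le_base; split=> //=.
    by rewrite (cyc_le_shift e) (cyc_le_trans a'b ba) a'b.
  rewrite (cyc_le_shift e); case: ifP => [a'e|_]; last by rewrite (cyc_le_trans a'b ba).
  by case/eqP: ae'; apply: (@cyc_le_anti _ _ e); rewrite a'e cyc_le_base.
exists e, b, a', b'; split; first by split.
by rewrite /cyc_lt ![e == _]eq_sym be [b == _]eq_sym n3 n2 cyc_le_base ab'2 ltN.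
Qed.

(** By separation, no element of [B] falls strictly between two elements of [A]. *)
Lemma cyc_convex_sub e A B I : cyc_separated e A B -> cyc_convex e A I ->
  cyc_convex e (A `|` B) I.
Proof.
move=> sep [sI cI]; split=> [|a b c aI]; first exact: fsubset_trans (fsubsetUl _ _).
rewrite inE => /orP[bA|bB] cI' ab bc; first exact: (cI a b c).
have [aA cA] := (fsubsetP sI _ aI, fsubsetP sI _ cI').
case: sep => sep.
  suff -> : b = c by [].
  by apply: (@cyc_le_anti _ _ e); rewrite bc sep.
suff -> : b = a by [].
by apply: (@cyc_le_anti _ _ e); rewrite ab sep.
Qed.

(* An interval meeting both sides leaves an initial or a final segment of each. *)
Lemma cyc_convex_diff e A B I b : cyc_separated e A B -> cyc_convex e (A `|` B) I ->
  b \in I -> b \in B -> cyc_convex e A (A `\` I).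
Proof.
move=> sep [sI cI] bI bB; split=> [|a1 a2 a3]; first exact: fsubsetDl.
rewrite !inE => /andP[a1I a1A] a2A /andP[a3I a3A] a12 a23; rewrite a2A andbT.
apply/negP => a2I; case: sep => sep.
  by case/negP: a3I; apply: (cI a2 a3 b) => //; [rewrite inE a3A | apply: sep].
by case/negP: a1I; apply: (cI b a1 a2) => //; [rewrite inE a1A | apply: sep].
Qed.

(** * Ranks of intervals in two 2-sums on the same ground sets *)

Section TwoSumEnvelope.
Variables (e : X) (P Q M N S S' : matroid X).
Hypotheses (sPQ : summable e P Q) (sMN : summable e M N).
Hypotheses (bS : two_sum_bases e P Q S) (bS' : two_sum_bases e M N S').
Hypotheses (gM : ground M = ground P) (gN : ground N = ground Q).
Hypothesis sep : cyc_separated e (ground P `\ e) (ground Q `\ e).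

Let A := ground P `\ e.
Let B := ground Q `\ e.

Lemma ground_two_sum : ground S = A `|` B.
Proof. by rewrite bS.1 fsetDUl. Qed.

Lemma ground_two_sum' : ground S' = ground S.
Proof. by rewrite bS.1 bS'.1 gM gN. Qed.

Lemma disjoint_parts : {in A, forall z, z \notin B}.
Proof.
move=> z; rewrite !inE negb_and negbK => /andP[ze zP].
have gE : ground P `&` ground Q = [fset e] by case: sPQ.
by rewrite (notin_other gE ze zP) orbT.
Qed.

Lemma rk_part I : necklace M = necklace P -> cyc_convex e A I ->
  rk M I = rk P I /\ rk M (e |` (A `\` I)) = rk P (e |` (A `\` I)).
Proof.
have eM := (summable_ground sMN).1.
by move/(necklace_convexD1 gM eM); rewrite gM; apply.
Qed.

(** For an interval inside one part, the complement contains the whole other part, so [two_sum_rkl]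
    and [two_sum_rkUl] apply. *)
Lemma rk_two_sum_part I : necklace M = necklace P -> necklace N = necklace Q ->
  cyc_convex e A I ->
  rk S' I = rk S I /\ rk S' ((A `\` I) `|` B) = rk S ((A `\` I) `|` B).
Proof.
move=> nM nN cI; have [rI rCI] := rk_part nM cI; have [sI _] := cI.
have sM : I `<=` ground M `\ e by rewrite gM.
rewrite (two_sum_rkl sMN bS' sM) (two_sum_rkl sPQ bS sI); split=> //.
have sC : A `\` I `<=` A by apply: fsubsetDl.
have sC' : A `\` I `<=` ground M `\ e by rewrite gM.
have := two_sum_rkUl sPQ bS sC; have := two_sum_rkUl sMN bS' sC'.
rewrite gN -/B rCI.
have eN := (summable_ground sMN).2.
have : rk N (ground Q) = rk Q (ground Q).
  have /(necklace_convexD1 gN eN)/(_ _ (cyc_convex0 _ _)) := nN.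
  by case=> _; rewrite fsetD0 fsetD1K // gN.
lia.
Qed.

(** The formulas of [two_sum_rkl] and [two_sum_rkUl] are solved for the ranks in [M]. The rank of
    [N] entering them is known because [B] is itself an interval of the 2-sum. *)
Lemma necklace_summand : necklace S' = necklace S -> necklace M = necklace P.
Proof.
have eM := (summable_ground sMN).1.
move/(necklace_convexP e ground_two_sum'); rewrite ground_two_sum' ground_two_sum => H.
have rB : rk N (ground Q) = rk Q (ground Q).
  have [rN rN'] := summable_rk (summableC sMN); have [rQ rQ'] := summable_rk (summableC sPQ).
  rewrite -{1}gN -rN' -rQ' gN.
  have sB : B `<=` ground N `\ e by rewrite gN.
  rewrite -/B -(two_sum_rkl (summableC sMN) (two_sum_basesC bS') sB).
  rewrite -(two_sum_rkl (summableC sPQ) (two_sum_basesC bS) (fsubset_refl _)) -/B.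
  have cB := cyc_convex_sub (cyc_separatedC sep) (cyc_convex_refl e B).
  by rewrite fsetUC in cB; have [] := H _ cB.
apply/(necklace_convexD1 gM eM); rewrite gM -/A => I cI; have [sI _] := cI.
have sM : I `<=` ground M `\ e by rewrite gM.
have [rI rCI] := H _ (cyc_convex_sub sep cI).
rewrite -(two_sum_rkl sMN bS' sM) -(two_sum_rkl sPQ bS sI); split=> //.
have sC : A `\` I `<=` A by apply: fsubsetDl.
have sC' : A `\` I `<=` ground M `\ e by rewrite gM.
have := two_sum_rkUl sPQ bS sC; have := two_sum_rkUl sMN bS' sC'.
rewrite gN -/B rB; move: rCI.
have -> : (A `|` B) `\` I = (A `\` I) `|` B; last by move=> ->; lia.
rewrite fsetDUl; congr (_ `|` _); apply/fsetP => z; rewrite in_fsetD.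
have [zI|//] := boolP (z \in I); apply/esym/negbTE.
exact/disjoint_parts/(fsubsetP sI).
Qed.

End TwoSumEnvelope.

Lemma envelope_summable e M N P Q : summable e P Q ->
  envelope P M -> envelope Q N -> summable e M N.
Proof.
move=> sPQ [gM nM] [gN nN]; have [eP eQ] := summable_ground sPQ.
have main K L : e \in ground L -> ground K = ground L -> necklace K = necklace L ->
    [/\ rk K [fset e] = rk L [fset e], rk K (ground L `\ e) = rk L (ground L `\ e)
      & rk K (ground L) = rk L (ground L)].
  move=> eL gK; have eK : e \in ground K by rewrite gK.
  move/(necklace_convexD1 gK eK); rewrite gK => H.
  have [-> r1] := H _ (cyc_convex_refl e _); have [_ r2] := H _ (cyc_convex0 e _).
  by move: r1 r2; rewrite fsetDv fsetU0 fsetD0 fsetD1K.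
by have [? ? ?] := main _ _ eP gM nM; have [? ? ?] := main _ _ eQ gN nN;
  exact: rk_summable sPQ _ _ _ _ _ _ _ _.
Qed.

Lemma necklace_two_sum e M N P Q S S' : summable e P Q -> summable e M N ->
  two_sum_bases e P Q S -> two_sum_bases e M N S' ->
  cyc_separated e (ground P `\ e) (ground Q `\ e) ->
  envelope P M -> envelope Q N -> necklace S' = necklace S.
Proof.
move=> sPQ sMN bS bS' sep [gM nM] [gN nN].
have gS := ground_two_sum bS; have gS' := ground_two_sum' bS bS' gM gN.
apply/(necklace_convexP e gS'); rewrite gS' gS => I cI.
set A := ground P `\ e in gS sep cI *; set B := ground Q `\ e in gS sep cI *.
have AB : {in A, forall z, z \notin B} := disjoint_parts sPQ.
have BA : {in B, forall z, z \notin A} by move=> z zB; apply/negP => /AB; rewrite zB.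
have cI' : cyc_convex e (B `|` A) I by rewrite fsetUC.
have cA := cyc_convexI (fsubsetUl A B) cI; have cB := cyc_convexI (fsubsetUr A B) cI.
have IE : I = (I `&` A) `|` (I `&` B) by apply: fsubset_splitU; case: cI.
have [Ib0|/fset0Pn[b]] := eqVneq (I `&` B) fset0.
  rewrite Ib0 fsetU0 in IE; rewrite -IE in cA.
  have [-> r] := rk_two_sum_part sPQ sMN bS bS' gM gN nM nN cA; split=> //.
  suff -> : (A `|` B) `\` I = A `\` I `|` B by [].
  rewrite fsetDUl; congr (_ `|` _); apply/fsetP => z; rewrite in_fsetD.
  have [zI|//] := boolP (z \in I); apply/esym/negbTE/AB.
  by apply: (fsubsetP _ z zI); case: cA.
rewrite inE => /andP[bI bB].
have [Ia0|/fset0Pn[a]] := eqVneq (I `&` A) fset0.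
  rewrite Ia0 fset0U in IE; rewrite -IE in cB.
  have [-> r] := rk_two_sum_part (summableC sPQ) (summableC sMN) (two_sum_basesC bS)
    (two_sum_basesC bS') gN gM nN nM cB; split=> //.
  suff -> : (A `|` B) `\` I = B `\` I `|` A by [].
  rewrite fsetDUl fsetUC; congr (_ `|` _); apply/fsetP => z; rewrite in_fsetD.
  have [zI|//] := boolP (z \in I); apply/esym/negbTE/BA.
  by apply: (fsubsetP _ z zI); case: cB.
rewrite inE => /andP[aI aA].
(* When [I] meets both parts, its trace on each part and the rest of that part are both convex. This
   fixes the ranks of all four sets, with and without [e], that occur in [two_sum_rk] for [I] and
   its complement. *)
have dA := cyc_convex_diff sep cI bI bB.
have dB := cyc_convex_diff (cyc_separatedC sep) cI' aI aA.
have [rA1 rA2] := rk_part sMN gM nM cA; have [rA3 rA4] := rk_part sMN gM nM dA.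
have [rB1 rB2] := rk_part (summableC sMN) gN nN cB.
have [rB3 rB4] := rk_part (summableC sMN) gN nN dB.
rewrite -/A -/B in rA2 rA4 rB2 rB4.
have DI C : C `\` (I `&` C) = C `\` I.
  by apply/fsetP => z; rewrite !inE; case: (z \in C); rewrite ?andbF ?andbT.
have DD C : C `\` (C `\` I) = I `&` C.
  by apply/fsetP => z; rewrite !inE; case: (z \in C); case: (z \in I).
rewrite !(DI, DD) in rA2 rA4 rB2 rB4.
have sP : I `&` A `<=` A by apply: fsubsetIr.
have sQ : I `&` B `<=` B by apply: fsubsetIr.
have tP : A `\` I `<=` A by apply: fsubsetDl.
have tQ : B `\` I `<=` B by apply: fsubsetDl.
have [sM sN] : I `&` A `<=` ground M `\ e /\ I `&` B `<=` ground N `\ e.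
  by rewrite gM gN.
have [tM tN] : A `\` I `<=` ground M `\ e /\ B `\` I `<=` ground N `\ e.
  by rewrite gM gN.
split; apply: succn_inj.
  rewrite {1 2}IE (two_sum_rk sMN bS' sM sN) (two_sum_rk sPQ bS sP sQ).
  by rewrite rA1 rA4 rB1 rB4.
rewrite fsetDUl (two_sum_rk sMN bS' tM tN) (two_sum_rk sPQ bS tP tQ).
by rewrite rA2 rA3 rB2 rB3.
Qed.

(** Both parts and the whole ground set are convex, so [S'] inherits from [S] the rank identity
    required by the decomposition; [necklace_summand] then places the summands in the envelopes. *)
Lemma envelope_two_sum_split e P Q S S' : summable e P Q -> two_sum_bases e P Q S ->
  cyc_separated e (ground P `\ e) (ground Q `\ e) ->
  2 <= #|` ground P| -> 2 <= #|` ground Q| -> envelope S S' ->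
  exists M N, [/\ envelope P M, envelope Q N, summable e M N & two_sum_bases e M N S'].
Proof.
move=> sPQ bS sep cP cQ [gS' nS']; have gS := ground_two_sum bS.
have [eP eQ] := summable_ground sPQ.
have [[_ rP] [_ rQ]] := (summable_rk sPQ, summable_rk (summableC sPQ)).
move/(necklace_convexP e gS'): (nS'); rewrite gS' gS => H.
set A := ground P `\ e in gS sep H rP *; set B := ground Q `\ e in gS sep H rQ *.
have AB : {in A, forall z, z \notin B} := disjoint_parts sPQ.
have rA : rk S' A = rk P (ground P).
  have [-> _] := H _ (cyc_convex_sub sep (cyc_convex_refl e A)).
  by rewrite (two_sum_rkl sPQ bS).
have rB : rk S' B = rk Q (ground Q).
  have := cyc_convex_sub (cyc_separatedC sep) (cyc_convex_refl e B).
  rewrite fsetUC => /H[-> _].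
  by rewrite (two_sum_rkl (summableC sPQ) (two_sum_basesC bS)).
have rS : (mrank S').+1 = (rk P (ground P) + rk Q (ground Q))%N.
  have [r _] := H _ (cyc_convex_refl e _); rewrite /mrank gS' gS r.
  by rewrite (two_sum_rkUl sPQ bS) // fsetD1K.
have nz K : 2 <= #|` ground K| -> e \in ground K -> ground K `\ e != fset0.
  by move=> + eK; rewrite (cardfsD1 e) eK -cardfs_gt0.
have [|||||M [N [gM gN sMN bS'']]] :=
    @exists_two_sum_decomposition _ S' A B e (etrans gS' gS) AB.
- by rewrite !inE eqxx.
- by rewrite !inE eqxx.
- exact: nz.
- exact: nz.
- by rewrite rA rB rS.
rewrite fsetD1K // in gM; rewrite fsetD1K // in gN.
exists M, N; split=> //; split=> //.
  exact: (necklace_summand sPQ sMN bS bS'' gM gN sep nS').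
exact: (necklace_summand (summableC sPQ) (summableC sMN) (two_sum_basesC bS)
  (two_sum_basesC bS'') gN gM (cyc_separatedC sep) nS').
Qed.

End Envelopes.

Theorem proposition2p25 (R : realType) (d : Order.disp_t) (X : orderType d)
    (P Q : matroid X) (e : X)
    (posP : positroid R P) (posQ : positroid R Q)
    (connP : tutte_connected 2 P) (connQ : tutte_connected 2 Q)
    (ncPQ : noncrossing (ground P) (ground Q))
    (cardP : 3 <= #|` ground P|) (cardQ : 3 <= #|` ground Q|)
    (capPQ : (ground P `&` ground Q)%fset = [fset e]%fset) :
  envelope (two_sum e P Q) = two_sum_class e (envelope P) (envelope Q).
Proof.
have [cP cQ] := (ltnW cardP, ltnW cardQ).
have [eP eQ] : e \in ground P /\ e \in ground Q.
  by apply/andP; rewrite -in_fsetI capPQ inE.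
have sPQ : summable e P Q.
  by split=> //; apply: connected_not_loop_coloop.
have bS := two_sum_bases_two_sum sPQ.
have sep := noncrossing_separated capPQ ncPQ.
(* Members of the envelope of the 2-sum are split first; then 2-sums of members of the envelopes are
   compared with the given 2-sum. *)
apply/seteqP; split=> [S' /(envelope_two_sum_split sPQ bS sep cP cQ)|S'].
  case=> M [N [eM eN sMN bS']]; exists M => //; exists N => //.
  exact/two_sumE/two_sum_bases_is_two_sum.
case=> M eM [N eN <-]; have sMN := envelope_summable sPQ eM eN.
have bS' := two_sum_bases_two_sum sMN; split.
  exact: (ground_two_sum' bS bS' eM.1 eN.1).
exact: necklace_two_sum sPQ sMN bS bS' sep eM eN.
Qed.
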